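(* Let $G$ be an arbitrary group, and let $\mathcal{V}$ be a vector space over a field $\mathbb{F}$ with a well-ordered basis $(\beta,\leq)$. Then any $G$-grading on $\mathrm{UT}_{\to\beta}\mathcal{V}$ is isomorphic to an elementary one $\Gamma(\gamma)$, defined by a map $\gamma\colon\beta\to G$. Moreover, for maps $\gamma,\gamma'\colon\beta\to G$, $\Gamma(\gamma)\cong\Gamma(\gamma')$ if and only if $\gamma=g\gamma'$ for some $g\in G$, where $(g\gamma')(u)=g\,\gamma'(u)$ for all $u\in\beta$.
   Context: For $u,v\in\beta$, the matrix unit $e_{uv}\in\mathrm{End}_{\mathbb{F}}\mathcal{V}$ is defined by $e_{uv}(v)=u$ and $e_{uv}(w)=0$ for $w\in\beta\setminus\{v\}$. $\mathrm{UT}_{\to\beta}\mathcal{V}=\mathrm{Span}\{e_{uv}\mid u\le v\in\beta\}$, a subalgebra of $\mathrm{End}_{\mathbb{F}}\mathcal{V}$. A $G$-grading on an algebra $\mathcal{A}$ is a vector space decomposition $\mathcal{A}=\bigoplus_{g\in G}\mathcal{A}_g$ with $\mathcal{A}_g\mathcal{A}_h\subseteq\mathcal{A}_{gh}$. Two $G$-gradings $\mathcal{A}=\bigoplus_g\mathcal{A}_g=\bigoplus_g\mathcal{A}'_g$ are isomorphic ($\cong$) if there is an algebra automorphism $f$ of $\mathcal{A}$ with $f(\mathcal{A}_g)=\mathcal{A}'_g$ for all $g$. For a map $\gamma\colon\beta\to G$, $\Gamma(\gamma)$ denotes the $G$-grading on $\mathrm{UT}_{\to\beta}\mathcal{V}$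 in which each $e_{uv}$ ($u\le v$) is homogeneous of degree $\gamma(u)^{-1}\gamma(v)$; such gradings are called elementary. *)

(* Defs.v *)
From HB Require Import structures.
From mathcomp Require Import all_boot all_order all_algebra.
From mathcomp Require Import all_classical.
Set Implicit Arguments.
Unset Strict Implicit.
Unset Printing Implicit Defensive.
Import Order.TTheory GRing.Theory.
Local Open Scope classical_set_scope.
Local Open Scope ring_scope.

Definition lin_span (F : fieldType) (W : lmodType F) (S : set W) : set W :=
  [set x | exists (n : nat) (a : 'I_n -> F) (s : 'I_n -> W),
     (forall i, S (s i)) /\ x = \sum_(i < n) a i *: s i].

Definition is_basis (F : fieldType) (V : lmodType F) (I : choiceType)
    (b : I -> V) : Prop :=
  (forall (s : seq I) (c : I -> F), uniq s ->
     \sum_(i <- s) c i *: b i = 0 -> forall i, i \in s -> c i = 0) /\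
  (forall x : V, lin_span (range b) x).

(* Endomorphisms are elements of the pointwise F-module V -> V; End_F V is the
   subspace of the linear ones, with composition as its product. *)
Definition is_matrix_unit (F : fieldType) (V : lmodType F) (I : choiceType)
    (b : I -> V) (u v : I) : set (V -> V) :=
  [set f | [/\ linear f, f (b v) = b u & forall w, w != v -> f (b w) = 0]].

(* The default value 0 is never used when b is a basis: see matrix_unitP. *)
Definition matrix_unit (F : fieldType) (V : lmodType F) (I : choiceType)
    (b : I -> V) (u v : I) : V -> V :=
  xget 0 (is_matrix_unit b u v).

Section MatrixUnit.
Variables (F : fieldType) (V : lmodType F) (I : choiceType) (b : I -> V).

Let comb (s : seq I) (c : I -> F) : V := \sum_(i <- s) c i *: b i.

Let comb_widen (s t : seq I) (c : I -> F) : uniq s -> uniq t ->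
  {subset s <= t} -> (forall i, i \notin s -> c i = 0) -> comb t c = comb s c.
Proof.
move=> us ut st c0; rewrite /comb (bigID (mem s)) /= [X in _ + X]big1 ?addr0; last first.
  by move=> i /c0 ->; rewrite scale0r.
rewrite -big_filter; apply/perm_big/uniq_perm => //; first exact: filter_uniq.
by move=> i; rewrite mem_filter; case: (boolP (i \in s)) => // /st ->.
Qed.

Let coords (x : V) (c : I -> F) : Prop := exists s,
  [/\ uniq s, forall i, i \notin s -> c i = 0 & x = comb s c].

Let coords_ex : is_basis b -> forall x, exists c, coords x c.
Proof.
move=> [_ spanb] x; have [n [a [s [rs ->]]]] := spanb x.
have /choice[k ks] i : exists j, s i = b j by have [j _ <-] := rs i; exists j.
exists (fun j => \sum_(i < n | k i == j) a i).
exists (undup [seq k i | i <- enum 'I_n]); split; first exact: undup_uniq.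
  move=> j; rewrite mem_undup => nj; rewrite big1 // => i /eqP kij.
  by case/negP: nj; rewrite -kij map_f ?mem_enum.
rewrite /comb; under [RHS]eq_bigr do rewrite scaler_suml.
rewrite (exchange_big_dep predT) //=; apply: eq_bigr => i _.
rewrite ks (big_rem (k i)) /= ?mem_undup ?map_f ?mem_enum // eqxx big_seq_cond.
rewrite big1 ?addr0 // => j /andP[+ /eqP kij].
by rewrite -kij mem_rem_uniq ?undup_uniq // inE eqxx.
Qed.

Let coords_lin (a : F) x y c e : coords x c -> coords y e ->
  coords (a *: x + y) (fun i => a * c i + e i).
Proof.
move=> [s [us c0 ->]] [t [ut e0 ->]]; have ust := undup_uniq (s ++ t).
have sub : {subset s <= undup (s ++ t)} /\ {subset t <= undup (s ++ t)}.
  by split=> i si; rewrite mem_undup mem_cat si ?orbT.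
exists (undup (s ++ t)); split=> // [i|].
  rewrite mem_undup mem_cat negb_or => /andP[/c0 -> /e0 ->].
  by rewrite mulr0 addr0.
rewrite -(comb_widen us ust sub.1 c0) -(comb_widen ut ust sub.2 e0) /comb.
rewrite scaler_sumr -big_split; apply: eq_bigr => i _.
by rewrite scalerDl scalerA.
Qed.

Let coords_uniq : is_basis b -> forall x c e, coords x c -> coords x e -> c = e.
Proof.
move=> [freeb _] x c e xc xe.
have := coords_lin (-1) xc xe; rewrite scaleN1r addNr => -[s [us d0 /esym z]].
apply/funext => i; apply/esym/eqP; rewrite -subr_eq0 addrC -mulN1r; apply/eqP.
by case: (boolP (i \in s)) => [|/d0 //]; exact: freeb z i.
Qed.

Lemma matrix_unit_ex u v : is_basis b -> exists f, is_matrix_unit b u v f.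
Proof.
move=> hb; have [c xc] := choice (coords_ex hb).
have cb w : c (b w) = fun i => (i == w)%:R.
  apply: (coords_uniq hb (xc _)); exists [:: w]; split=> // [i|].
    by rewrite inE => /negbTE ->.
  by rewrite /comb big_seq1 eqxx scale1r.
exists (fun x => c x v *: b u); split=> [a x y|/=|w wv /=].
- rewrite (coords_uniq hb (xc _) (coords_lin a (xc x) (xc y))).
  by rewrite scalerDl scalerA.
- by rewrite cb eqxx scale1r.
- by rewrite cb eq_sym (negbTE wv) scale0r.
Qed.

Lemma matrix_unitP u v : is_basis b ->
  is_matrix_unit b u v (matrix_unit b u v).
Proof. by move=> hb; apply: xgetPex; exact: matrix_unit_ex. Qed.

End MatrixUnit.

Definition UT (F : fieldType) (V : lmodType F) (d : Order.disp_t)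
    (I : orderType d) (b : I -> V) : set (V -> V) :=
  lin_span [set f | exists u v : I, (u <= v)%O /\ f = matrix_unit b u v].

Definition is_grading (G : groupType) (F : fieldType) (V : lmodType F)
    (A : set (V -> V)) (Ag : G -> set (V -> V)) : Prop :=
  [/\ forall g, submod_closed (mem (Ag g)) /\ Ag g `<=` A,
      forall x, A x -> exists (s : seq G) (c : G -> V -> V),
        [/\ uniq s, forall g, Ag g (c g) & x = \sum_(g <- s) c g],
      forall (s : seq G) (c : G -> V -> V), uniq s ->
        (forall g, Ag g (c g)) -> \sum_(g <- s) c g = 0 ->
        forall g, g \in s -> c g = 0
    & forall g h x y, Ag g x -> Ag h y -> Ag (g * h)%g (x \o y)].

(* Only the values of phi on A matter. *)
Definition is_algebra_automorphism (F : fieldType) (V : lmodType F)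
    (A : set (V -> V)) (phi : (V -> V) -> (V -> V)) : Prop :=
  [/\ set_bij A A phi,
      forall a x y, A x -> A y -> phi (a *: x + y) = a *: phi x + phi y
    & forall x y, A x -> A y -> phi (x \o y) = phi x \o phi y].

Definition isomorphic_gradings (G : groupType) (F : fieldType)
    (V : lmodType F) (A : set (V -> V)) (Ag Ag' : G -> set (V -> V)) : Prop :=
  exists phi : (V -> V) -> (V -> V),
    is_algebra_automorphism A phi /\ forall g, phi @` Ag g = Ag' g.

Definition elementary (G : groupType) (F : fieldType) (V : lmodType F)
    (d : Order.disp_t) (I : orderType d) (b : I -> V) (gamma : I -> G) (g : G) :
    set (V -> V) :=
  lin_span [set f | exists u v : I,
    [/\ (u <= v)%O, ((gamma u)^-1 * gamma v)%g = g & f = matrix_unit b u v]].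

(* Main.v *)
(** For each u the rows <= u form a two-sided ideal, and well-founded induction
    on u shows that all these ideals are graded.  The first row carries the space W
    of finitely supported covectors, so W and then V become graded, in duality,
    and a rank one operator p (x) q with p, q homogeneous is homogeneous.  The grading
    is therefore elementary as soon as V has a homogeneous unitriangular basis p_u
    whose dual covectors q_u span W, for then conjugation by b_u |-> p_u is an
    automorphism of the algebra.  The obvious candidates, the homogeneous components of
    the b_u, fail the last condition in general.  But the projections of V onto
    its homogeneous components have matrices that are locally finite in both directions,
    so the index set splits into countable blocks stable under all of them.
    In each block a dual pair of bases is built by a countable sequence of one-vector
    extensions, scheduled so that every coordinate functional ends up in the span.
    For uniqueness, an automorphism permutes the diagonal characters by an
    order-preserving bijection of a well-order, which is the identity; so it keeps the
    (u, v) entry of e_uv nonzero, and this entry determines the degree. *)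

Require Import Defs.
From mathcomp Require Import all_boot all_order all_algebra.
From mathcomp Require Import all_classical.
From mathcomp Require wochoice.

Set Implicit Arguments.
Unset Strict Implicit.
Unset Printing Implicit Defensive.
Import Order.TTheory GRing.Theory.
Local Open Scope classical_set_scope.
Local Open Scope ring_scope.

(** * Linear maps, spans and sums of finite support *)

Section LinearMaps.
Variables (F : fieldType) (U W : lmodType F) (f : U -> W).
Hypothesis lf : linear f.

Lemma linmap0 : f 0 = 0.
Proof. by have := lf (-1) 0 0; rewrite scaler0 add0r scaleN1r addNr. Qed.

Lemma linmapD x y : f (x + y) = f x + f y.
Proof. by have := lf 1 x y; rewrite !scale1r. Qed.

Lemma linmapZ a x : f (a *: x) = a *: f x.
Proof. by have := lf a x 0; rewrite linmap0 !addr0. Qed.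

Lemma linmapB x y : f (x - y) = f x - f y.
Proof. by rewrite -scaleN1r linmapD linmapZ scaleN1r. Qed.

Lemma linmap_sum (K : Type) (s : seq K) (P : pred K) (x : K -> U) :
  f (\sum_(i <- s | P i) x i) = \sum_(i <- s | P i) f (x i).
Proof. by apply: big_morph; [exact: linmapD | exact: linmap0]. Qed.

End LinearMaps.

Section Span.
Variables (F : fieldType) (W : lmodType F) (S : set W).

Lemma lin_span0 : lin_span S 0.
Proof. by exists 0%N, (fun=> 0), (fun=> 0); split; [case | rewrite big_ord0]. Qed.

Lemma lin_span_gen x : S x -> lin_span S x.
Proof.
move=> Sx; exists 1%N, (fun=> 1), (fun=> x); split=> //.
by rewrite big_ord1 scale1r.
Qed.

Lemma lin_spanZ a x : lin_span S x -> lin_span S (a *: x).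
Proof.
move=> [n [c [s [Ss ->]]]]; exists n, (fun i => a * c i), s; split=> //.
by rewrite scaler_sumr; apply: eq_bigr => i _; rewrite scalerA.
Qed.

Lemma lin_spanD x y : lin_span S x -> lin_span S y -> lin_span S (x + y).
Proof.
move=> [n [c [s [Ss ->]]]] [m [e [t [St ->]]]].
exists (n + m)%N,
  (fun i : 'I_(n + m) => match fintype.split i with inl j => c j | inr j => e j end),
  (fun i : 'I_(n + m) => match fintype.split i with inl j => s j | inr j => t j end); split.
  by move=> i; case: (fintype.split i).
rewrite big_split_ord /=; congr (_ + _); apply: eq_bigr => i _.
  case: splitP => j /= ij; first by congr (c _ *: s _); apply: val_inj.
  by have := ltn_ord i; rewrite ij ltnNge leq_addr.
case: splitP => j /= ij; first by have := ltn_ord j; rewrite -ij ltnNge leq_addr.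
by move/addnI: ij => ij; congr (e _ *: t _); apply: val_inj.
Qed.

Lemma lin_span_sum (K : eqType) (s : seq K) (x : K -> W) :
  (forall i, i \in s -> lin_span S (x i)) -> lin_span S (\sum_(i <- s) x i).
Proof.
move=> Sx; rewrite big_seq; elim/big_ind: _ => //; first exact: lin_span0.
exact: lin_spanD.
Qed.

End Span.

Lemma lin_span_ind (F : fieldType) (W : lmodType F) (S P : set W) :
  P 0 -> (forall a x y, P x -> P y -> P (a *: x + y)) -> S `<=` P ->
  lin_span S `<=` P.
Proof.
move=> P0 PD SP _ [n [a [s [Ss ->]]]].
apply: (big_ind P) => // [x y Px Py|i _]; first by rewrite -[x]scale1r; apply: PD.
by rewrite -[_ *: _]addr0; apply: PD => //; apply: SP.
Qed.

Lemma lin_span_sub (F : fieldType) (W : lmodType F) (S T : set W) :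
  S `<=` lin_span T -> lin_span S `<=` lin_span T.
Proof.
move=> ST; apply: lin_span_ind => //; first exact: lin_span0.
by move=> a x y Tx Ty; apply: lin_spanD => //; exact: lin_spanZ.
Qed.

Lemma sum_supp (K : eqType) (M : nmodType) (s t : seq K) (f : K -> M) :
  uniq s -> uniq t -> (forall i, i \notin s -> f i = 0) ->
  (forall i, i \notin t -> f i = 0) ->
  \sum_(i <- s) f i = \sum_(i <- t) f i.
Proof.
move=> us ut fs ft; rewrite (bigID (mem t)) /= [X in _ + X]big1 ?addr0 //.
rewrite [RHS](bigID (mem s)) /= [X in _ + X]big1 ?addr0 //.
rewrite -big_filter -[RHS]big_filter; apply/perm_big/uniq_perm; rewrite ?filter_uniq //.
by move=> i; rewrite !mem_filter andbC.
Qed.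

Lemma sum_app (K : Type) (U : Type) (M : nmodType) (s : seq K) (f : K -> U -> M) (p : U) :
  (\sum_(i <- s) f i) p = \sum_(i <- s) f i p.
Proof. by rewrite fct_sumE. Qed.

(** * Coordinates and triangular operators *)

Section Coordinates.
Variables (F : fieldType) (V : lmodType F) (d : Order.disp_t).
Variables (I : orderType d) (b : I -> V).
Hypothesis hb : is_basis b.
Implicit Types (u v w i j : I) (x y p : V).

Lemma basis_neq0 u : b u != 0.
Proof.
apply/eqP => bu; have := hb.1 [:: u] (fun=> 1) isT.
rewrite big_seq1 bu scaler0 => /(_ erefl u); rewrite inE eqxx => /(_ isT)/eqP.
by rewrite oner_eq0.
Qed.

Lemma bcoord_ex u x : exists c, matrix_unit b u u x = c *: b u.
Proof.
have [le eu e0] := matrix_unitP u u hb.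
have : lin_span (range b) x by apply: hb.2.
move: x; apply: lin_span_ind => [|a x y [c xE] [e yE]|_ [v _ <-]].
- by exists 0; rewrite scale0r linmap0.
- by exists (a * c + e); rewrite le xE yE scalerDl scalerA.
- have [->|/e0 ->] := eqVneq v u; first by exists 1; rewrite scale1r.
  by exists 0; rewrite scale0r.
Qed.

(** The codomain is [F^o], the field as a module over itself, so that covectors form a module and
    are linear maps. *)
Definition bcoord (u : I) : V -> F^o := projT1 (choice (bcoord_ex u)).

Lemma bcoordE u x : matrix_unit b u u x = bcoord u x *: b u.
Proof. exact: (projT2 (choice (bcoord_ex u))). Qed.

Lemma scale_basis_inj u : injective (fun a => a *: b u).
Proof.
move=> a c /eqP; rewrite -subr_eq0 -scalerBl scaler_eq0 (negbTE (basis_neq0 u)).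
by rewrite orbF subr_eq0 => /eqP.
Qed.

Lemma bcoord_linear u : linear (bcoord u).
Proof.
have [le _ _] := matrix_unitP u u hb.
move=> a x y; apply: (@scale_basis_inj u); rewrite /=.
by rewrite -bcoordE le !bcoordE scalerDl scalerA.
Qed.

Lemma bcoord_basis u v : bcoord u (b v) = (u == v)%:R.
Proof.
have [_ eu e0] := matrix_unitP u u hb; apply: (@scale_basis_inj u); rewrite /=.
rewrite -bcoordE; have [<-|uv] := eqVneq u v; first by rewrite eu scale1r.
by rewrite e0 1?eq_sym // scale0r.
Qed.

Lemma bcoordP u a x y : bcoord u (a *: x + y) = a * bcoord u x + bcoord u y.
Proof. exact: bcoord_linear. Qed.

Lemma bcoord0 u : bcoord u 0 = 0.
Proof. exact: linmap0 (bcoord_linear u). Qed.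

Lemma bcoordZ u a x : bcoord u (a *: x) = a * bcoord u x.
Proof. exact: linmapZ (bcoord_linear u) _ _. Qed.

Lemma bcoordB u x y : bcoord u (x - y) = bcoord u x - bcoord u y.
Proof. exact: linmapB (bcoord_linear u) _ _. Qed.

Lemma bcoord_sum u (K : Type) (s : seq K) (P : pred K) (x : K -> V) :
  bcoord u (\sum_(i <- s | P i) x i) = \sum_(i <- s | P i) bcoord u (x i).
Proof. by rewrite (linmap_sum (bcoord_linear u)). Qed.

Lemma bcoord_expand x : exists s : seq I,
  [/\ uniq s, forall u, u \notin s -> bcoord u x = 0
    & x = \sum_(u <- s) bcoord u x *: b u].
Proof.
have : lin_span (range b) x by apply: hb.2.
move: x; apply: lin_span_ind => [|a x y [s [us s0 xE]] [t [ut t0 yE]]|_ [v _ <-]].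
- exists [::]; split=> // [u _|]; last by rewrite big_nil.
  exact: linmap0 (bcoord_linear u).
- have c0 (z : V) (r : seq I) : {subset r <= s ++ t} ->
      (forall u, u \notin r -> bcoord u z = 0) ->
      forall u, u \notin undup (s ++ t) -> bcoord u z = 0.
    by move=> rst r0 u; rewrite mem_undup => /(contra (rst u)) /r0.
  have sst : {subset s <= s ++ t} by move=> u; rewrite mem_cat => ->.
  have tst : {subset t <= s ++ t} by move=> u; rewrite mem_cat orbC => ->.
  exists (undup (s ++ t)); split; first exact: undup_uniq.
    by move=> u nu; rewrite bcoordP (c0 x s) ?(c0 y t) // mulr0 addr0.
  rewrite {1}xE {1}yE scaler_sumr.
  rewrite (@sum_supp _ _ s (undup (s ++ t))) ?undup_uniq //; first last.
  + by move=> u nu; rewrite (c0 x s) // scale0r scaler0.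
  + by move=> u /s0 ->; rewrite scale0r scaler0.
  rewrite (@sum_supp _ _ t (undup (s ++ t))) ?undup_uniq //; first last.
  + by move=> u nu; rewrite (c0 y t) // scale0r.
  + by move=> u /t0 ->; rewrite scale0r.
  rewrite -big_split; apply: eq_bigr => u _ /=.
  by rewrite bcoordP scalerDl scalerA.
- exists [:: v]; split=> // [u|]; last by rewrite big_seq1 bcoord_basis eqxx scale1r.
  by rewrite inE bcoord_basis => /negbTE ->.
Qed.

Lemma bcoord_ext x y : (forall u, bcoord u x = bcoord u y) -> x = y.
Proof.
move=> xy; have [s [us s0 ->]] := bcoord_expand x; have [t [ut t0 ->]] := bcoord_expand y.
rewrite (@sum_supp _ _ s t) // => [||u ut'].
- by apply: eq_bigr => u _; rewrite xy.
- by move=> u /s0 ->; rewrite scale0r.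
- by rewrite xy t0 // scale0r.
Qed.

Lemma linmap_expand (W : lmodType F) (f : V -> W) x : linear f ->
  exists s : seq I, [/\ uniq s, forall u, u \notin s -> bcoord u x = 0
    & f x = \sum_(u <- s) bcoord u x *: f (b u)].
Proof.
move=> lf; have [s [us s0 xE]] := bcoord_expand x; exists s; split=> //.
by rewrite {1}xE linmap_sum //; apply: eq_bigr => u _; rewrite linmapZ.
Qed.

Lemma linmap_ext (W : lmodType F) (f g : V -> W) : linear f -> linear g ->
  (forall u, f (b u) = g (b u)) -> f = g.
Proof.
move=> lf lg fg; apply/funext => x; have [s [_ _ xE]] := bcoord_expand x.
rewrite xE !linmap_sum //; apply: eq_bigr => u _.
by rewrite !linmapZ // fg.
Qed.

(** The formula uses a chosen support of [x]; by [fE] any list containing the support gives the same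
    value, and linearity is checked on a list common to [x] and [y]. *)
Lemma linear_extension (W : lmodType F) (h : I -> W) :
  exists2 f : V -> W, linear f & forall u, f (b u) = h u.
Proof.
pose f x := \sum_(u <- projT1 (cid (bcoord_expand x))) bcoord u x *: h u.
have fE x t : uniq t -> (forall u, u \notin t -> bcoord u x = 0) ->
    f x = \sum_(u <- t) bcoord u x *: h u.
  move=> ut t0; rewrite /f; case: cid => s [us s0 _] /=.
  by apply: sum_supp => // u; [move/s0 | move/t0] => ->; rewrite scale0r.
exists f => [a x y|u]; last first.
  rewrite (@fE _ [:: u]) ?big_seq1 ?bcoord_basis ?eqxx ?scale1r // => v.
  by rewrite inE bcoord_basis => /negbTE ->.
have [s [us s0 _]] := bcoord_expand x; have [t [ut t0 _]] := bcoord_expand y.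
have s1 u : u \notin undup (s ++ t) -> bcoord u x = 0.
  by rewrite mem_undup mem_cat negb_or => /andP[/s0].
have t1 u : u \notin undup (s ++ t) -> bcoord u y = 0.
  by rewrite mem_undup mem_cat negb_or => /andP[_ /t0].
rewrite !(@fE _ (undup (s ++ t))) ?undup_uniq //; last first.
  by move=> u nu; rewrite bcoordP s1 ?t1 // mulr0 addr0.
rewrite scaler_sumr -big_split; apply: eq_bigr => u _ /=.
by rewrite bcoordP scalerDl scalerA.
Qed.

End Coordinates.

Section Triangular.
Variables (F : fieldType) (V : lmodType F) (d : Order.disp_t).
Variables (I : orderType d) (b : I -> V).
Hypothesis hb : is_basis b.
Implicit Types (u v w i j : I) (p : V) (x y : V -> V) (q : V -> F^o).
Local Notation co := (bcoord hb).
Local Notation A := (UT b).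
Local Notation e := (matrix_unit b).

(** The flag of [V]: the span of the [b w] with [w <= u], and for [sbelow] with [w < u]. *)
Definition below u p := forall w, (u < w)%O -> co w p = 0.
Definition sbelow u p := forall w, (u <= w)%O -> co w p = 0.

Definition rank_one p q : V -> V := fun z => q z *: p.

(** These are the finite combinations of coordinate functionals, see [finitary_expand]. *)
Definition finitary q := linear q /\ exists X : seq I, forall v, v \notin X -> q (b v) = 0.

Definition row_below u q := forall w, (w < u)%O -> q (b w) = 0.

Lemma below_basis u : below u (b u).
Proof. by move=> w uw; rewrite bcoord_basis gt_eqF. Qed.

Lemma sbelow_sub u p : below u p -> sbelow u (p - co u p *: b u).
Proof.
move=> pu w; rewrite bcoordB bcoordZ bcoord_basis.
rewrite le_eqVlt => /orP[/eqP <-|uw]; first by rewrite eqxx mulr1 subrr.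
by rewrite pu // gt_eqF // mulr0 subrr.
Qed.

Lemma below_lin u a p p' : below u p -> below u p' -> below u (a *: p + p').
Proof. by move=> pu p'u w uw; rewrite bcoordP pu ?p'u // mulr0 addr0. Qed.

Lemma below0 u : below u 0.
Proof. by move=> w _; rewrite bcoord0. Qed.

Lemma matrix_unitE u v : e u v = rank_one (b u) (co v).
Proof.
have [le eu e0] := matrix_unitP u v hb.
apply: (linmap_ext hb) => // [a x y|w].
  by rewrite /rank_one bcoordP scalerDl scalerA.
rewrite /rank_one bcoord_basis; have [<-|vw] := eqVneq v w.
  by rewrite eu scale1r.
by rewrite scale0r e0 // eq_sym.
Qed.

Lemma rank_one_linear p q : linear q -> linear (rank_one p q).
Proof. by move=> lq a x y; rewrite /rank_one lq scalerDl scalerA. Qed.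

Lemma bcoord_finitary u : finitary (co u).
Proof.
split; first exact: bcoord_linear; exists [:: u] => v.
by rewrite inE bcoord_basis eq_sym => /negbTE ->.
Qed.

Lemma finitary0 : finitary 0.
Proof. by split; [move=> a x y; rewrite scaler0 addr0 | exists [::]]. Qed.

Lemma finitary_lin a q q' : finitary q -> finitary q' -> finitary (a *: q + q').
Proof.
move=> [lq [X X0]] [lq' [Y Y0]]; split.
  by move=> c p p'; rewrite !fctE lq lq' !scalerDr addrACA !scalerA [a * c]mulrC.
exists (X ++ Y) => v; rewrite mem_cat negb_or => /andP[/X0 x0 /Y0 y0].
by rewrite !fctE x0 y0 scaler0 addr0.
Qed.

Lemma finitaryZ a q : finitary q -> finitary (a *: q).
Proof. by move=> fq; rewrite -[_ *: _]addr0; apply: finitary_lin => //; exact: finitary0. Qed.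

Lemma finitary_expand q : finitary q -> exists X : seq I,
  [/\ uniq X, forall v, v \notin X -> q (b v) = 0
    & q = \sum_(i <- X) q (b i) *: co i].
Proof.
move=> [lq [X qX]]; exists (undup X); split; first exact: undup_uniq.
  by move=> v; rewrite mem_undup => /qX.
apply: (linmap_ext hb) => // [a x y|u].
  rewrite !fct_sumE scaler_sumr -big_split; apply: eq_bigr => i _ /=.
  by rewrite !fctE bcoord_linear scalerDr !scalerA mulrC.
rewrite fct_sumE; case: (boolP (u \in X)) => uX; last first.
  rewrite qX // big_seq big1 // => i; rewrite mem_undup fctE bcoord_basis => iX.
  by case: eqVneq uX => [<-|_]; rewrite ?iX ?scaler0.
rewrite (bigD1_seq u) ?mem_undup ?undup_uniq //= big1 ?addr0.
  by rewrite fctE bcoord_basis eqxx [_ *: _]mulr1.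
by move=> i /negbTE iu; rewrite fctE bcoord_basis iu scaler0.
Qed.

Lemma UT_matrix_unit u v : (u <= v)%O -> A (e u v).
Proof. by move=> uv; apply: lin_span_gen; exists u, v. Qed.

(** In the expansion into units [e i j], a nonzero coefficient needs [i <= u] from [p] and [u <= j]
    from [q]. *)
Lemma UT_rank_one u p q : below u p -> finitary q -> row_below u q -> A (rank_one p q).
Proof.
move=> pu fq qu; have [X [_ _ qE]] := finitary_expand fq.
have [s [_ _ pE]] := bcoord_expand hb p.
have -> : rank_one p q = \sum_(i <- s) \sum_(j <- X) (co i p * q (b j)) *: e i j.
  apply/funext => v; rewrite /rank_one {1}pE {1}qE !fct_sumE.
  rewrite scaler_sumr; apply: eq_bigr => i _.
  rewrite fct_sumE scaler_suml; apply: eq_bigr => j _.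
  by rewrite !fctE matrix_unitE /rank_one !scalerA mulrC -mulrA.
apply: lin_span_sum => i _; apply: lin_span_sum => j _.
have [ui|iu] := ltP u i; first by rewrite pu // mul0r scale0r; exact: lin_span0.
have [ju|uj] := ltP j u; first by rewrite qu // mulr0 scale0r; exact: lin_span0.
by apply: lin_spanZ; apply: UT_matrix_unit; exact: le_trans uj.
Qed.

(** An intrinsic description of the algebra: operators that preserve the flag and have finitely many
    nonzero columns. Such an operator is the sum of its columns, each triangular of rank at most
    one. *)
Lemma UTP x : A x <-> [/\ linear x, forall u, below u (x (b u))
  & exists X : seq I, forall v, v \notin X -> x (b v) = 0].
Proof.
split.
  move: x; apply: lin_span_ind.
  - split=> [a y z|u|] /=; [by rewrite scaler0 addr0 | exact: below0 | by exists [::]].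
  - move=> a x y [lx ux [X xX]] [ly uy [Y yY]]; split=> [c v w|u|].
    + by rewrite !fctE lx ly scalerDr addrACA scalerDr !scalerA mulrC.
    + exact: below_lin.
    + exists (X ++ Y) => v; rewrite mem_cat negb_or => /andP[/xX x0 /yY y0].
      by rewrite !fctE x0 y0 scaler0 addr0.
  - move=> _ [u [v [uv ->]]]; rewrite matrix_unitE; split=> [|w|].
    + by apply: rank_one_linear; exact: bcoord_linear.
    + rewrite /rank_one bcoord_basis -[_ *: _]addr0; have [<-|vw] := eqVneq v w.
        apply: below_lin; last exact: below0.
        by move=> i /(le_lt_trans uv); exact: below_basis.
      by rewrite scale0r addr0; exact: below0.
    + exists [:: v] => w; rewrite inE /rank_one bcoord_basis eq_sym => /negbTE ->.
      by rewrite scale0r.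
move=> [lx ux [X xX]].
have -> : x = \sum_(v <- undup X) rank_one (x (b v)) (co v).
  apply: (linmap_ext hb) => // [a y z|u].
    rewrite !fct_sumE scaler_sumr -big_split; apply: eq_bigr => v _ /=.
    by rewrite rank_one_linear //; exact: bcoord_linear.
  rewrite fct_sumE; case: (boolP (u \in X)) => uX; last first.
    rewrite xX // big_seq big1 // => i; rewrite mem_undup /rank_one bcoord_basis => iX.
    by case: eqVneq uX => [<-|_]; rewrite ?iX ?scale0r.
  rewrite (bigD1_seq u) ?mem_undup ?undup_uniq //= big1 ?addr0.
    by rewrite /rank_one bcoord_basis eqxx scale1r.
  by move=> i /negbTE iu; rewrite /rank_one bcoord_basis iu scale0r.
apply: lin_span_sum => v _; apply: (@UT_rank_one v) => //; first exact: bcoord_finitary.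
by move=> w wv; rewrite bcoord_basis gt_eqF.
Qed.

Lemma UT_linear x : A x -> linear x.
Proof. by case/UTP. Qed.

Lemma UT_sbelow u x p : A x -> sbelow u p -> sbelow u (x p).
Proof.
move=> /UTP[lx ux _] pu w uw; have [s [_ _ ->]] := linmap_expand hb p lx.
rewrite bcoord_sum big1 // => i _; rewrite bcoordZ.
have [ui|iu] := leP u i; first by rewrite pu // mul0r.
by rewrite ux ?mulr0 // (lt_le_trans iu).
Qed.

(** The scalar by which [x] acts on the line [below u] modulo [sbelow u], hence a character of the
    algebra. *)
Definition diag u x := co u (x (b u)).

Lemma UT_coord u x p w : A x -> below u p -> (u <= w)%O ->
  co w (x p) = co u p * co w (x (b u)).
Proof.
move=> Ax pu uw; have lx := UT_linear Ax.
have {1}-> : p = co u p *: b u + (p - co u p *: b u) by rewrite addrC subrK.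
by rewrite lx bcoordP (UT_sbelow Ax (sbelow_sub pu)) // addr0.
Qed.

Lemma UT_below u x p : A x -> below u p -> below u (x p).
Proof.
move=> Ax pu w uw; rewrite (UT_coord Ax pu (ltW uw)).
by have [_ -> //] := (UTP x).1 Ax; rewrite mulr0.
Qed.

Lemma UT_sub_diag u x p : A x -> below u p -> sbelow u (x p - diag u x *: p).
Proof.
move=> Ax pu w uw; rewrite bcoordB bcoordZ.
rewrite (UT_coord Ax pu uw); move: uw; rewrite le_eqVlt => /orP[/eqP <-|uw].
  by rewrite mulrC subrr.
by have [_ -> //] := (UTP x).1 Ax; rewrite mulr0 pu // mulr0 subrr.
Qed.

Lemma diag_coord u x p : A x -> below u p -> co u (x p) = diag u x * co u p.
Proof. by move=> Ax pu; rewrite (UT_coord Ax pu) // mulrC. Qed.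

Lemma diag_comp u x y : A x -> A y -> diag u (x \o y) = diag u x * diag u y.
Proof.
by move=> Ax /UTP[_ uy _]; rewrite /diag /= (diag_coord Ax).
Qed.

Lemma diag_lin u a x y : diag u (a *: x + y) = a * diag u x + diag u y.
Proof. by rewrite /diag fctE bcoordP. Qed.

Lemma diag_matrix_unit u v w : diag u (e v w) = ((u == v) && (w == u))%:R.
Proof.
rewrite matrix_unitE /diag /rank_one bcoordZ.
by rewrite !bcoord_basis andbC -natrM mulnb.
Qed.

Lemma UT_comp x y : A x -> A y -> A (x \o y).
Proof.
move=> Ax Ay; have [lx _ _] := (UTP x).1 Ax.
have [ly uy [Y yY]] := (UTP y).1 Ay; apply/UTP; split.
- by move=> a v w /=; rewrite ly lx.
- by move=> u; exact: UT_below Ax (uy u).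
- by exists Y => v /yY /= ->; rewrite linmap0.
Qed.

Lemma UT_lin a x y : A x -> A y -> A (a *: x + y).
Proof. by move=> Ax Ay; apply: lin_spanD => //; exact: lin_spanZ. Qed.

Lemma UT0 : A 0.
Proof. exact: lin_span0. Qed.

End Triangular.

Lemma well_order_ind (d : Order.disp_t) (I : orderType d) (P : I -> Prop) :
  wochoice.well_order (fun u v : I => (u <= v)%O) ->
  (forall u, (forall w, (w < u)%O -> P w) -> P u) -> forall u, P u.
Proof.
move=> wo IH u; apply: contrapT => nPu.
have [|w [[/asboolP nPw wmin] _]] := wo (fun v => `[< ~ P v >]).
  by exists u; apply/asboolP.
apply: nPw; apply: IH => v vw; apply: contrapT => nPv.
have : (w <= v)%O by apply: wmin; apply/asboolP.
by rewrite leNgt vw.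
Qed.

(** * Homogeneous components *)

Section Components.
Variables (G : groupType) (F : fieldType) (V : lmodType F) (d : Order.disp_t).
Variables (I : orderType d) (b : I -> V).
Hypothesis hb : is_basis b.
Variable Ag : G -> set (V -> V).
Hypothesis hG : is_grading (UT b) Ag.
Implicit Types (g h k : G) (x y z : V -> V) (c e : G -> V -> V).
Local Notation co := (bcoord hb).
Local Notation A := (UT b).

Lemma grade0 g : Ag g 0.
Proof. by have [/(_ g)[[/set_mem]]] := hG. Qed.

Lemma grade_lin g a x y : Ag g x -> Ag g y -> Ag g (a *: x + y).
Proof.
have [/(_ g)[[_ L] _] _ _ _] := hG => gx gy.
by apply/set_mem/L; apply/mem_set.
Qed.

Lemma grade_UT g x : Ag g x -> A x.
Proof. by have [/(_ g)[_ +] _ _ _] := hG; apply. Qed.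

Lemma grade_comp g h x y : Ag g x -> Ag h y -> Ag (g * h)%g (x \o y).
Proof. by have [_ _ _] := hG; apply. Qed.

Lemma grade_sum g (K : Type) (s : seq K) (f : K -> V -> V) :
  (forall i, Ag g (f i)) -> Ag g (\sum_(i <- s) f i).
Proof.
move=> gf; apply: (big_ind (Ag g)) => // [|x y gx gy]; first exact: grade0.
by rewrite -[x]scale1r; apply: grade_lin.
Qed.

(** The family is a finitely supported function on all of [G], so that uniqueness becomes an
    equality of functions. *)
Definition decomposes x c := exists s : seq G,
  [/\ uniq s, forall g, Ag g (c g), forall g, g \notin s -> c g = 0
    & x = \sum_(g <- s) c g].

Lemma decomposes_ex x : A x -> exists c, decomposes x c.
Proof.
have [_ + _ _] := hG => /[apply] -[s [c [us gc ->]]].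
exists (fun g => if g \in s then c g else 0), s; split=> // [g|g /negbTE -> //|].
  by case: ifP => _; [exact: gc | exact: grade0].
by rewrite big_seq [RHS]big_seq; apply: eq_bigr => g ->.
Qed.

Lemma decomposes_lin a x y c e : decomposes x c -> decomposes y e ->
  decomposes (a *: x + y) (fun g => a *: c g + e g).
Proof.
move=> [s [us gc s0 ->]] [t [ut ge t0 ->]]; exists (undup (s ++ t)).
have s1 g : g \notin undup (s ++ t) -> c g = 0.
  by rewrite mem_undup mem_cat negb_or => /andP[/s0].
have t1 g : g \notin undup (s ++ t) -> e g = 0.
  by rewrite mem_undup mem_cat negb_or => /andP[_ /t0].
split; first exact: undup_uniq.
- by move=> g; apply: grade_lin.
- by move=> g ng; rewrite s1 ?t1 // scaler0 addr0.
rewrite big_split -scaler_sumr /=; congr (_ *: _ + _).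
  by apply: sum_supp; rewrite ?undup_uniq.
by apply: sum_supp; rewrite ?undup_uniq.
Qed.

Lemma decomposes_uniq x c e : decomposes x c -> decomposes x e -> c = e.
Proof.
move=> xc xe; have := decomposes_lin (-1) xc xe.
rewrite scaleN1r addNr => -[s [us gd d0 /esym z]].
have [_ _ free _] := hG; apply/funext => g; apply/esym/eqP.
rewrite -subr_eq0 addrC -scaleN1r; apply/eqP.
by case: (boolP (g \in s)) => [|/d0 //]; exact: free us gd z g.
Qed.

Definition hcomp x : G -> V -> V := xget (fun=> 0) (decomposes x).

Lemma hcompP x : A x -> decomposes x (hcomp x).
Proof. by move=> /decomposes_ex; exact: xgetPex. Qed.

Lemma hcompE x c : decomposes x c -> hcomp x = c.
Proof. by move=> xc; exact: decomposes_uniq (xgetI _ xc) xc. Qed.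

Lemma hcomp_grade x g : A x -> Ag g (hcomp x g).
Proof. by move=> /hcompP[s []]. Qed.

Lemma hcomp_UT x g : A x -> A (hcomp x g).
Proof. by move=> Ax; exact: grade_UT (hcomp_grade g Ax). Qed.

Lemma hcomp_sum x : A x -> exists s : seq G,
  [/\ uniq s, forall g, g \notin s -> hcomp x g = 0 & x = \sum_(g <- s) hcomp x g].
Proof. by move=> /hcompP[s [us _ s0 xE]]; exists s. Qed.

Lemma hcomp_lin a x y g : A x -> A y ->
  hcomp (a *: x + y) g = a *: hcomp x g + hcomp y g.
Proof. by move=> Ax Ay; rewrite (hcompE (decomposes_lin a (hcompP Ax) (hcompP Ay))). Qed.

Lemma hcomp0 g : hcomp 0 g = 0.
Proof.
by have := hcomp_lin (-1) g (UT0 b) (UT0 b); rewrite scaleN1r addNr scaleN1r addNr.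
Qed.

Lemma hcompZ a x g : A x -> hcomp (a *: x) g = a *: hcomp x g.
Proof. by move=> Ax; have := hcomp_lin a g Ax (UT0 b); rewrite hcomp0 !addr0. Qed.

Lemma UT_sum (K : Type) (s : seq K) (f : K -> V -> V) :
  (forall i, A (f i)) -> A (\sum_(i <- s) f i).
Proof.
move=> Af; apply: (big_ind A) => // [|x y Ax Ay]; first exact: UT0.
by rewrite -[x]scale1r; apply: UT_lin.
Qed.

Lemma hcomp_big (K : Type) (s : seq K) (f : K -> V -> V) g :
  (forall i, A (f i)) -> hcomp (\sum_(i <- s) f i) g = \sum_(i <- s) hcomp (f i) g.
Proof.
move=> Af; elim: s => [|i s IH]; first by rewrite !big_nil hcomp0.
rewrite !big_cons -{1}[f i]scale1r hcomp_lin ?IH ?scale1r //.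
exact: UT_sum.
Qed.

Lemma hcomp_homog g h x : Ag g x -> hcomp x h = if h == g then x else 0.
Proof.
move=> gx; rewrite (@hcompE x (fun h => if h == g then x else 0)) //.
exists [:: g]; split=> // [k|k|]; last by rewrite big_seq1 eqxx.
  by case: eqP => [->|_] //; exact: grade0.
by rewrite inE => /negbTE ->.
Qed.

Lemma hcomp_only x g : A x -> (forall h, h != g -> hcomp x h = 0) -> Ag g x.
Proof.
move=> Ax x0; have [s [us s0 ->]] := hcomp_sum Ax.
by apply: grade_sum => h; have [->|/x0 ->] := eqVneq h g; [exact: hcomp_grade | exact: grade0].
Qed.

(** A homogeneous factor shifts degrees: the shifted family decomposes the product, and
    decompositions are unique. *)
Lemma hcomp_mull h x y g : Ag h x -> A y -> hcomp (x \o y) g = x \o hcomp y (h^-1 * g)%g.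
Proof.
move=> hx Ay; have [s [us s0 yE]] := hcomp_sum Ay; have lx := UT_linear hb (grade_UT hx).
rewrite (@hcompE _ (fun g => x \o hcomp y (h^-1 * g)%g)) //.
exists [seq (h * k)%g | k <- s]; split.
- by rewrite map_inj_uniq //; exact: mulgI.
- move=> k; have -> : k = (h * (h^-1 * k))%g by rewrite mulVKg.
  by apply: grade_comp => //; rewrite mulKg; exact: hcomp_grade.
- move=> k nk; rewrite s0; first by apply/funext => v /=; rewrite linmap0.
  by apply: contra nk => ks; apply/mapP; exists (h^-1 * k)%g => //; rewrite mulVKg.
- rewrite big_map {1}yE; apply/funext => v /=; rewrite !fct_sumE linmap_sum //.
  by apply: eq_bigr => k _ /=; rewrite mulKg.
Qed.

Lemma hcomp_mulr h x y g : A x -> Ag h y -> hcomp (x \o y) g = hcomp x (g * h^-1)%g \o y.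
Proof.
move=> Ax hy; have [s [us s0 xE]] := hcomp_sum Ax.
rewrite (@hcompE _ (fun g => hcomp x (g * h^-1)%g \o y)) //.
exists [seq (k * h)%g | k <- s]; split.
- by rewrite map_inj_uniq //; exact: mulIg.
- move=> k; have -> : k = ((k * h^-1) * h)%g by rewrite mulgVK.
  by apply: grade_comp => //; rewrite mulgK; exact: hcomp_grade.
- move=> k nk; rewrite s0 //.
  by apply: contra nk => ks; apply/mapP; exists (k * h^-1)%g => //; rewrite mulgVK.
- rewrite big_map {1}xE; apply/funext => v /=; rewrite !fct_sumE.
  by apply: eq_bigr => k _ /=; rewrite mulgK.
Qed.

End Components.

(** * The row ideals are graded *)

Section RowIdeals.
Variables (G : groupType) (F : fieldType) (V : lmodType F) (d : Order.disp_t).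
Variables (I : orderType d) (b : I -> V).
Hypothesis hb : is_basis b.
Hypothesis hwo : wochoice.well_order (fun u v : I => (u <= v)%O).
Variable Ag : G -> set (V -> V).
Hypothesis hG : is_grading (UT b) Ag.
Implicit Types (g h k : G) (x y z : V -> V) (u v w i j r : I) (p : V).
Local Notation co := (bcoord hb).
Local Notation A := (UT b).
Local Notation e := (matrix_unit b).
Local Notation hcomp := (hcomp Ag).

Lemma diag_sum u (K : Type) (s : seq K) (f : K -> V -> V) :
  diag hb u (\sum_(i <- s) f i) = \sum_(i <- s) diag hb u (f i).
Proof. by rewrite /diag fct_sumE bcoord_sum. Qed.

Lemma matrix_unitK u v w : e u v \o e v w = e u w.
Proof.
apply/funext => p; rewrite /= !(matrix_unitE hb) /rank_one bcoordZ.
by rewrite bcoord_basis eqxx mulr1.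
Qed.

Lemma UT_rows x : A x -> exists Y : seq I,
  uniq Y /\ x = \sum_(i <- Y) (e i i \o x).
Proof.
move=> Ax; have [Y Y0] : exists Y : seq I, forall i p, i \notin Y -> co i (x p) = 0.
  move: x Ax; apply: lin_span_ind => [|a x y [X X0] [Y Y0]|_ [u [v [uv ->]]]].
  - by exists [::] => i p _; rewrite bcoord0.
  - exists (X ++ Y) => i p; rewrite mem_cat negb_or => /andP[iX iY].
    by rewrite bcoordP X0 ?Y0 // mulr0 addr0.
  - exists [:: u] => i p; rewrite inE (matrix_unitE hb) bcoordZ bcoord_basis.
    by move=> /negbTE ->; rewrite mulr0.
exists (undup Y); split; first exact: undup_uniq.
apply/funext => p; apply: (bcoord_ext (hb := hb)) => u; rewrite fct_sumE bcoord_sum.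
have [uY|uY] := boolP (u \in Y).
  rewrite (bigD1_seq u) ?mem_undup ?undup_uniq //= big1 ?addr0.
    by rewrite (matrix_unitE hb) bcoordZ bcoord_basis eqxx mulr1.
  by move=> i iu; rewrite (matrix_unitE hb) bcoordZ bcoord_basis eq_sym (negbTE iu) mulr0.
rewrite Y0 // big_seq big1 // => i; rewrite mem_undup => iY /=.
rewrite (matrix_unitE hb) bcoordZ bcoord_basis; case: eqVneq uY => [->|_]; last by rewrite mulr0.
by rewrite iY.
Qed.

(** Passes from the ideals of rows [<= w], for [w < u], to the ideal of rows [< u]: an element of it
    is a finite sum of rows [e i i \o x], and the hypothesis covers each nonzero one. *)
Lemma hcomp_below_step u :
  (forall w, (w < u)%O -> forall x, A x -> (forall p, below hb w (x p)) ->
     forall g p, below hb w (hcomp x g p)) ->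
  forall x, A x -> (forall p, sbelow hb u (x p)) ->
     forall g p, sbelow hb u (hcomp x g p).
Proof.
move=> IH x Ax xu g p w uw; have [Y [_ xE]] := UT_rows Ax.
have Ae i : A (e i i \o x) by apply: UT_comp => //; exact: UT_matrix_unit.
rewrite xE (hcomp_big hG) // fct_sumE bcoord_sum big1 // => i _.
have [ui|iu] := leP u i.
  have -> : e i i \o x = 0.
    by apply/funext => q; rewrite /= (matrix_unitE hb) /rank_one xu // scale0r.
  by rewrite (hcomp0 hG) bcoord0.
apply: (IH i iu) => //; last exact: lt_le_trans uw.
move=> q j ij; rewrite /= (matrix_unitE hb) bcoordZ bcoord_basis.
by rewrite gt_eqF // mulr0.
Qed.

(* Modulo the ideal of rows < u, the algebra acts on the row u through the
   character diag u; hence, for homogeneous x of degree h and y in the rows <= u,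
   x * y_g and diag u x * y_(h g) agree modulo that ideal.  If y_g had a nonzero
   entry in a row r > u, then h |-> diag u (e_ur)_h would be constant on the
   degrees h that matter, and e_ur = e_ur e_rr would force this constant to be
   a multiple of diag u e_rr = 0. *)
Lemma hcomp_below u x : A x -> (forall p, below hb u (x p)) ->
  forall g p, below hb u (hcomp x g p).
Proof.
move: u x; apply: (well_order_ind hwo) => u /hcomp_below_step IH y Ay yu g p.
(* [x \o z - diag u x *: z] has only rows [< u]; by induction so has its component of degree
   [h * k], to which [x] contributes by shifting the degree [k] part of [z]. *)
have act h x z k q w : Ag h x -> A z -> (forall p, below hb u (z p)) -> (u <= w)%O ->
    co w (x (hcomp z k q)) = diag hb u x * co w (hcomp z (h * k)%g q).
  move=> hx Az zu uw; have Ax := grade_UT hG hx.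
  have Axz : A (x \o z) by exact: UT_comp.
  have zu' q' : sbelow hb u ((- diag hb u x *: z + (x \o z)) q').
    move=> i ui; have := UT_sub_diag Ax (zu q') ui.
    by rewrite [x _ - _]addrC -scaleNr.
  have := IH _ (UT_lin (- diag hb u x) Az Axz) zu' (h * k)%g q w uw.
  rewrite (hcomp_lin hG) // (hcomp_mull hb hG _ hx) // mulKg bcoordP mulNr => /eqP.
  by rewrite addrC subr_eq0 => /eqP.
have [y0 r ur|] := pselect (forall q, sbelow hb u (hcomp y g q)).
  by apply: y0; exact: ltW.
move=> /existsNP[v0 /existsNP[w0 /not_implyP[uw0 /eqP y0]]] r ur.
have Ax : A (e u r) by apply: UT_matrix_unit; exact: ltW.
have Ayg := hcomp_UT hG g Ay.
have Axy : A (e u r \o hcomp y g) by exact: UT_comp.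
have xyu q : below hb u ((e u r \o hcomp y g) q).
  by move=> w uw; rewrite /= (matrix_unitE hb) bcoordZ bcoord_basis gt_eqF // mulr0.
(* Write x_h for the components of [e u r]. The product of [a], x_h and y_g is evaluated twice by
   [act]: as [a] times a component of [e u r \o hcomp y g], and as the product of [a] and x_h times
   y_g. Common nonzero factors cancel. *)
have key k a h q w : Ag k a -> (u <= w)%O ->
    diag hb u a * co w (hcomp y (k * h * g)%g q) != 0 ->
    diag hb u (hcomp (e u r) h) = diag hb u (hcomp (e u r) (k * h)%g).
  move=> ka uw; rewrite mulf_eq0 negb_or => /andP[a0 c0].
  have gx h' : Ag h' (hcomp (e u r) h') by exact: (hcomp_grade hG).
  have E1 := act k a _ (h * g)%g q w ka Axy xyu uw.
  have gyg : Ag g (hcomp y g) by exact: (hcomp_grade hG).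
  rewrite !(hcomp_mulr hG _ Ax gyg) mulgK mulgA mulgK /= in E1.
  have := act _ _ y g q w (grade_comp hG ka (gx h)) Ay yu uw.
  rewrite /= E1 (act _ _ y g q w (gx _) Ay yu uw).
  rewrite (diag_comp hb _ (grade_UT hG ka) (grade_UT hG (gx h))) mulrA.
  by move=> /(mulIf c0)/(mulfI a0).
(* Since [e u r = e u r \o e r r], the degree 1 component is a sum over [k] of products of
   components of degrees [k^-1] and [k]. By [key], applied at the nonzero entry [v0], [w0], the
   first factors all count as x_1, which leaves a multiple of [diag u (e r r) = 0]. *)
have x1 : diag hb u (hcomp (e u r) 1%g) = 0.
  have Ad : A (e r r) by exact: UT_matrix_unit.
  have [t [_ _ dE]] := hcomp_sum hG Ad.
  have gd k : Ag k (hcomp (e r r) k) by exact: (hcomp_grade hG).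
  have Axd k : A (e u r \o hcomp (e r r) k) by apply: UT_comp => //; exact: (hcomp_UT hG).
  have : hcomp (e u r) 1%g = \sum_(k <- t) (hcomp (e u r) k^-1%g \o hcomp (e r r) k).
    rewrite -{1}(matrix_unitK u r r) {1}dE.
    have -> : e u r \o (\sum_(k <- t) hcomp (e r r) k) =
        \sum_(k <- t) (e u r \o hcomp (e r r) k).
      apply/funext => q; rewrite /= !fct_sumE linmap_sum //.
      exact: UT_linear Ax.
    rewrite (hcomp_big hG) //; apply: eq_bigr => k _.
    by rewrite (hcomp_mulr hG _ Ax (gd k)) mul1g.
  move=> /(congr1 (diag hb u)); rewrite diag_sum => ->.
  rewrite (eq_bigr (fun k => diag hb u (hcomp (e u r) 1%g) * diag hb u (hcomp (e r r) k))).
    rewrite -mulr_sumr -diag_sum -dE diag_matrix_unit.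
    by rewrite lt_eqF // mulr0.
  move=> k _; rewrite (diag_comp hb) //; try exact: (hcomp_UT hG).
  have [->|d0] := eqVneq (diag hb u (hcomp (e r r) k)) 0; first by rewrite !mulr0.
  congr (_ * _); rewrite -(mulgV k); apply: (key _ _ _ v0 w0 (gd k)) => //.
  by rewrite mulgV mul1g mulf_neq0.
have [t [_ _ xE]] := hcomp_sum hG Ax.
(* [e u r] moves row [r] of y_g to row [u], where each x_h acts through its diagonal entry; [key]
   equates every entry that matters with that of x_1, which is zero. *)
have : co u (e u r (hcomp y g p)) = co r (hcomp y g p).
  by rewrite (matrix_unitE hb) bcoordZ bcoord_basis eqxx mulr1.
move=> <-; rewrite xE fct_sumE bcoord_sum big1 // => h _.
have gx : Ag h (hcomp (e u r) h) by exact: (hcomp_grade hG).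
rewrite (act _ _ _ _ _ _ gx) //; apply/eqP; apply: contraT => c0.
have := key h _ 1%g p u gx (lexx u); rewrite mulg1 x1 => /(_ c0) /esym x0.
by rewrite x0 mul0r eqxx in c0.
Qed.

End RowIdeals.

(** * The induced gradings of vectors and covectors *)

Section Pairing.
Variables (F : fieldType) (V : lmodType F) (d : Order.disp_t).
Variables (I : orderType d) (b : I -> V).
Hypothesis hb : is_basis b.
Implicit Types (u v w i j : I) (p : V) (x y : V -> V) (q : V -> F^o).
Local Notation co := (bcoord hb).

Lemma row_below_sbelow u p q : linear q -> row_below b u q -> sbelow hb u p -> q p = 0.
Proof.
move=> lq qu pu; have [s [_ _ ->]] := linmap_expand hb p lq.
rewrite big1 // => i _; have [ui|iu] := leP u i; first by rewrite pu // scale0r.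
by rewrite qu // scaler0.
Qed.

Lemma row_below_below u p q : linear q -> row_below b u q -> below hb u p ->
  q p = co u p * q (b u).
Proof.
move=> lq qu pu; rewrite -[q p](subrK (co u p *: q (b u))) -(linmapZ lq) -(linmapB lq).
by rewrite (row_below_sbelow lq qu (sbelow_sub pu)) add0r linmapZ.
Qed.

(* The columns of P g have bounded support uniformly in g, and so do its rows:
   this local finiteness is what makes the dual bases below exist. *)
Record projections (G : groupType) (gamma : I -> G) (P : G -> V -> V) : Prop := Projections {
  proj_linear : forall g, linear (P g);
  proj_below : forall g u, below hb u (P g (b u));
  proj_diag : forall g u, co u (P g (b u)) = (g == gamma u)%:R;
  proj_orth : forall g h p, P g (P h p) = if g == h then P g p else 0;
  proj_row : forall i, exists X : seq I, forall u, u \notin X -> forall g, co i (P g (b u)) = 0;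
  proj_col : forall u, exists X : seq I, forall i, i \notin X -> forall g, co i (P g (b u)) = 0;
  proj_sum : forall i, exists s : seq G, co i = \sum_(g <- s) (co i \o P g)
}.

End Pairing.

Section DualGrading.
Variables (G : groupType) (F : fieldType) (V : lmodType F) (d : Order.disp_t).
Variables (I : orderType d) (b : I -> V).
Hypothesis hb : is_basis b.
Hypothesis hwo : wochoice.well_order (fun u v : I => (u <= v)%O).
Variable Ag : G -> set (V -> V).
Hypothesis hG : is_grading (UT b) Ag.
Variable o : I.
Hypothesis ho : forall u, (o <= u)%O.
Implicit Types (g h k : G) (x y z : V -> V) (u v w i j r : I) (p : V) (q : V -> F^o).
Local Notation co := (bcoord hb).
Local Notation A := (UT b).
Local Notation e := (matrix_unit b).
Local Notation hcomp := (hcomp Ag).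

(* Covectors are identified with the first row of the algebra. *)
Definition first_row q : V -> V := rank_one (b o) q.

Lemma UT_first_row q : finitary b q -> A (first_row q).
Proof.
move=> fq; apply: (@UT_rank_one _ _ _ _ _ hb o) => //; first exact: below_basis.
by move=> w; rewrite ltNge ho.
Qed.

Lemma first_row_below q p : below hb o (first_row q p).
Proof. by move=> w ow; rewrite /first_row /rank_one bcoordZ bcoord_basis gt_eqF // mulr0. Qed.

Lemma bcoord_first_row q p : co o (first_row q p) = q p.
Proof. by rewrite /first_row /rank_one bcoordZ bcoord_basis eqxx mulr1. Qed.

Definition qcomp q g : V -> F^o := fun p => co o (hcomp (first_row q) g p).

(** The ideal of rows [<= o] is the first row, so [hcomp_below] keeps every component in it. *)
Lemma first_row_qcomp q g : finitary b q -> first_row (qcomp q g) = hcomp (first_row q) g.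
Proof.
move=> fq; apply/funext => p; apply: (bcoord_ext (hb := hb)) => u.
rewrite /first_row /rank_one bcoordZ bcoord_basis; have [->|uo] := eqVneq u o.
  by rewrite mulr1.
rewrite mulr0; apply/esym/(hcomp_below hwo hG (UT_first_row fq)).
  exact: first_row_below.
by rewrite lt_neqAle eq_sym uo ho.
Qed.

Lemma qcomp_finitary q g : finitary b q -> finitary b (qcomp q g).
Proof.
move=> /UT_first_row/(hcomp_UT hG g)/(UTP hb)[lx _ [X X0]]; split.
  by move=> a p p'; rewrite /qcomp lx bcoordP.
by exists X => v /X0 x0; rewrite /qcomp x0 bcoord0.
Qed.

Lemma first_row_qcomp_grade q g : finitary b q -> Ag g (first_row (qcomp q g)).
Proof.
by move=> fq; rewrite first_row_qcomp //; apply: (hcomp_grade hG); exact: UT_first_row.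
Qed.

Lemma qcomp_sum q : finitary b q -> exists s : seq G,
  [/\ uniq s, forall g, g \notin s -> qcomp q g = 0 & q = \sum_(g <- s) qcomp q g].
Proof.
move=> fq; have [s [us s0 qE]] := hcomp_sum hG (UT_first_row fq).
exists s; split=> // [g gs|]; first by apply/funext => p; rewrite /qcomp s0 // bcoord0.
apply/funext => p; rewrite sum_app /qcomp -bcoord_sum -sum_app -qE.
by rewrite bcoord_first_row.
Qed.

Lemma qcomp_homog q g h : Ag g (first_row q) -> qcomp q h = if h == g then q else 0.
Proof.
move=> gq; apply/funext => p; rewrite /qcomp (hcomp_homog hG _ gq); case: eqP => _.
  exact: bcoord_first_row.
exact: bcoord0.
Qed.

Lemma qcomp_lin a q q' g : finitary b q -> finitary b q' ->
  qcomp (a *: q + q') g = a *: qcomp q g + qcomp q' g.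
Proof.
move=> fq fq'; have E : first_row (a *: q + q') = a *: first_row q + first_row q'.
  by apply/funext => p; rewrite /first_row /rank_one !fctE scalerDl !scalerA.
apply/funext => p; rewrite /qcomp E (hcomp_lin hG) ?bcoordP //; exact: UT_first_row.
Qed.

Lemma qcomp0 g : qcomp 0 g = 0.
Proof.
have row0 : first_row 0 = 0 by apply/funext => p; rewrite /first_row /rank_one scale0r.
apply/funext => p; rewrite /qcomp row0.
by rewrite (hcomp0 hG) bcoord0.
Qed.

Lemma qcompZ a q g : finitary b q -> qcomp (a *: q) g = a *: qcomp q g.
Proof.
by move=> fq; rewrite -[a *: q]addr0 qcomp_lin // ?qcomp0 ?addr0 //; exact: finitary0.
Qed.

(** The components of [e u u] map into [below u], where [q] is zero; so [qcomp q g] composed with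
    one of them is a component of a zero product. Their sum [e u u] fixes [b u]. *)
Lemma qcomp_vanish q g u : finitary b q ->
  (forall w, (w <= u)%O -> q (b w) = 0) -> qcomp q g (b u) = 0.
Proof.
move=> fq qu; have Ae : A (e u u) by exact: UT_matrix_unit.
have [s [_ _ eE]] := hcomp_sum hG Ae; have Aq := UT_first_row fq.
have ge h : Ag h (hcomp (e u u) h) by exact: (hcomp_grade hG).
have [lq' _] := qcomp_finitary g fq.
have eu : e u u (b u) = b u by rewrite (matrix_unitE hb) /rank_one bcoord_basis eqxx scale1r.
rewrite -eu eE sum_app linmap_sum // big1 // => h _.
have := hcomp_mulr hG (g * h)%g Aq (ge h); rewrite mulgK -first_row_qcomp //.
have -> : first_row q \o hcomp (e u u) h = 0.
  apply/funext => p; rewrite /= /first_row /rank_one.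
  have [lq _] := fq; have pu : below hb u (hcomp (e u u) h p).
    apply: (hcomp_below hwo hG Ae) => p' w uw.
    by rewrite (matrix_unitE hb) bcoordZ bcoord_basis gt_eqF // mulr0.
  rewrite (row_below_below lq _ pu) ?qu ?mulr0 ?scale0r //.
  by move=> w /ltW /qu.
rewrite (hcomp0 hG) => /(congr1 (fun f => f (b u))) /= /esym/eqP.
by rewrite scaler_eq0 (negbTE (basis_neq0 hb o)) orbF => /eqP.
Qed.

Lemma qcomp_row_below q g u : finitary b q -> row_below b u q -> row_below b u (qcomp q g).
Proof.
move=> fq qu w wu; apply: qcomp_vanish => // v vw.
by apply: qu; exact: le_lt_trans wu.
Qed.

Lemma row_below_bcoord u : row_below b u (co u).
Proof. by move=> w wu; rewrite bcoord_basis gt_eqF. Qed.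

(** The components of [co u] have values at [b u] with sum 1, so one is nonzero. If another were, a
    combination of the two would vanish at [b u] and at all smaller basis vectors, and by
    [qcomp_vanish] so would its homogeneous parts. *)
Lemma degree_ex u : exists k, forall g, qcomp (co u) g (b u) = (g == k)%:R.
Proof.
have fu := bcoord_finitary hb u; have [s [us s0 uE]] := qcomp_sum fu.
have sum1 : \sum_(g <- s) qcomp (co u) g (b u) = 1.
  by rewrite -sum_app -uE bcoord_basis eqxx.
have [k k0] : exists k, qcomp (co u) k (b u) != 0.
  apply: contrapT => /forallNP nk; move: sum1; rewrite big1 => [/esym/eqP|g _].
    by rewrite oner_eq0.
  by apply/eqP; apply: contraT => /nk.
have uniqk g : g != k -> qcomp (co u) g (b u) = 0.
  move=> gk; pose c k := qcomp (co u) k (b u).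
  pose z : V -> F^o := c g *: qcomp (co u) k + - c k *: qcomp (co u) g.
  have fk h := qcomp_finitary h fu.
  have fz : finitary b z by apply: finitary_lin => //; exact: finitaryZ.
  have zu : qcomp z k (b u) = 0.
    apply: qcomp_vanish => // w; rewrite le_eqVlt => /orP[/eqP ->|wu].
      by rewrite /z !fctE scaleNr [_ *: _]mulrC subrr.
    have rk h := qcomp_row_below h fu (@row_below_bcoord u).
    by rewrite /z !fctE !rk // !scaler0 addr0.
  have gk' h := first_row_qcomp_grade h fu.
  move: zu; rewrite /z qcomp_lin ?qcompZ; try exact: fk; try exact: finitaryZ (fk _).
  rewrite !(qcomp_homog _ (gk' _)) eqxx eq_sym (negbTE gk) scaler0 addr0 => /eqP.
  by rewrite fctE mulf_eq0 (negbTE k0) orbF => /eqP.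
have [sk|/s0 k1] := boolP (k \in s); last by rewrite k1 eqxx in k0.
exists k => g; case: eqVneq => [->|/uniqk //].
by move: sum1; rewrite (bigD1_seq k) //= big1 ?addr0 // => h /uniqk.
Qed.

(** [V] is graded by duality: the transpose of [P g] sends a finitary covector to its component of
    degree [g]. *)
Lemma projections_ex : exists (gamma : I -> G) (P : G -> V -> V),
  projections hb gamma P /\
  forall k l u p q, P k p = p -> below hb u p -> finitary b q -> row_below b u q ->
    q \o P l = q -> Ag (k^-1 * l)%g (rank_one p q).
Proof.
have [gamma gammaE] := choice degree_ex.
have Ae u : A (e u u) by exact: UT_matrix_unit.
have ge u h : Ag h (hcomp (e u u) h) by exact: (hcomp_grade hG).
(* A vector of degree [g] and a covector of degree [gamma u] should give a rank one operator of
   degree [g^-1 * gamma u]; here [e u u] is made of [b u] and [co u], and [gamma u] is the leading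
   degree of [co u]. *)
pose h g u := hcomp (e u u) (g^-1 * gamma u)%g (b u).
have hP g : exists f : V -> V, linear f /\ forall u, f (b u) = h g u.
  by have [f lf fE] := linear_extension hb (h g); exists f.
have [P lPE] := choice hP.
have lP g := (lPE g).1; have PE g u := (lPE g).2 u.
(* At [b u]: the first row of [qcomp q k] times [e u u] is a multiple of that of [co u], and by
   [gammaE] its component of degree [k * (g^-1 * gamma u)] vanishes at [b u] unless [k = g]. *)
have qP q g : finitary b q -> q \o P g = qcomp q g.
  move=> fq; have fqk k := qcomp_finitary k fq.
  apply: (linmap_ext hb); [|by case: (fqk g)|].
    by case: fq => lq _ a p p' /=; rewrite lP lq.
  move=> u; have [s [us s0 qE]] := qcomp_sum fq.
  have qk k : qcomp q k (h g u) = if k == g then qcomp q k (b u) else 0.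
    have := hcomp_mull hb hG (k * (g^-1 * gamma u))%g (first_row_qcomp_grade k fq) (Ae u).
    rewrite mulKg => /(congr1 (fun f => co o (f (b u)))) /=.
    rewrite [RHS]bcoord_first_row => <-.
    have -> : first_row (qcomp q k) \o e u u = qcomp q k (b u) *: first_row (co u).
      apply/funext => p /=; rewrite fctE (matrix_unitE hb) /first_row /rank_one.
      by rewrite linmapZ ?scalerA; [rewrite mulrC | case: (fqk k)].
    rewrite (hcompZ hG) ?fctE ?bcoordZ; last exact/UT_first_row/bcoord_finitary.
    rewrite -/(qcomp (co u) _ _) gammaE mulgA -{2}[gamma u]mul1g (inj_eq (mulIg _)).
    by rewrite divg_eq1; case: eqP => _; rewrite ?mulr1 ?mulr0.
  rewrite /= PE {1}qE sum_app (eq_bigr _ (fun k _ => qk k)) -big_mkcond.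
  have [gs|gs] := boolP (g \in s).
    rewrite -big_filter filter_pred1_uniq //= ?big_seq1 //.
  rewrite big_seq_cond big1 ?s0 // => k /andP[ks /eqP kg].
  by rewrite -kg ks in gs.
have fco i := bcoord_finitary hb i.
have coP i g p : co i (P g p) = qcomp (co i) g p by rewrite -(qP _ _ (fco i)).
have qPh q g k : finitary b q -> qcomp q g \o P k = if k == g then qcomp q g else 0.
  move=> fq; rewrite (qP _ _ (qcomp_finitary g fq)).
  exact: qcomp_homog (first_row_qcomp_grade g fq).
exists gamma, P; split.
  split=> //.
  - by move=> g u; rewrite PE; have [_ + _] := (UTP hb _).1 (hcomp_UT hG (g^-1 * gamma u)%g (Ae u)).
  - by move=> g u; rewrite coP gammaE.
  - move=> g k p; apply: (bcoord_ext (hb := hb)) => i; rewrite coP.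
    have := congr1 (fun f => f p) (qPh (co i) g k (fco i)) => /= ->.
    by rewrite eq_sym; case: eqP => _; [rewrite coP | rewrite bcoord0].
  - move=> i; have [s [_ s0 _]] := qcomp_sum (fco i).
    have /choice[X X0] g : exists X : seq I, forall u, u \notin X -> qcomp (co i) g (b u) = 0.
      by have [] := qcomp_finitary g (fco i).
    exists (flatten [seq X g | g <- s]) => u nu g; rewrite coP.
    have [gs|/s0 -> //] := boolP (g \in s); apply: X0; apply: contra nu => uX.
    by apply/flattenP; exists (X g) => //; exact: map_f.
  - move=> u; have [s [_ s0 _]] := hcomp_sum hG (Ae u).
    have /choice[X X0] k : exists X : seq I,
        forall i, i \notin X -> co i (hcomp (e u u) k (b u)) = 0.
      by have [X [_ X0 _]] := bcoord_expand hb (hcomp (e u u) k (b u)); exists X.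
    exists (flatten [seq X k | k <- s]) => i ni g; rewrite PE /h.
    have [gs|/s0 ->] := boolP ((g^-1 * gamma u)%g \in s); last by rewrite bcoord0.
    apply: X0; apply: contra ni => uX.
    by apply/flattenP; exists (X (g^-1 * gamma u)%g) => //; exact: map_f.
  - move=> i; have [s [_ _ sE]] := qcomp_sum (fco i); exists s; rewrite {1}sE.
    by apply: eq_bigr => g _; rewrite qP.
move=> k l u p q pk pu fq qu ql; have Aa := UT_rank_one pu fq qu.
have lq := fq.1.
have gq : Ag l (first_row q) by rewrite -ql qP //; exact: first_row_qcomp_grade.
(* The component of degree [m] is tested against the parts of each [co i]. The part of degree [g]
   turns the operator into a multiple of [q], so only [g * m = l] survives; the multiple is its
   value at [p], zero unless [g = k]. *)
apply: (hcomp_only hG Aa) => m mkl; apply/funext => z; apply: (bcoord_ext (hb := hb)) => i.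
rewrite -[(0 : V -> V) z]/(0 : V) bcoord0.
have [s [_ _ sE]] := qcomp_sum (fco i); rewrite sE sum_app big1 // => g _.
have gi := first_row_qcomp_grade g (fco i).
have := hcomp_mull hb hG (g * m)%g gi Aa; rewrite mulKg.
have -> : first_row (qcomp (co i) g) \o rank_one p q = qcomp (co i) g p *: first_row q.
  apply/funext => z' /=; rewrite fctE /first_row /rank_one.
  by rewrite linmapZ ?scalerA; [rewrite mulrC | case: (qcomp_finitary g (fco i))].
rewrite (hcompZ hG); last exact: UT_first_row.
rewrite (hcomp_homog hG _ gq) => /(congr1 (fun f => co o (f z))) /=.
rewrite [RHS]bcoord_first_row => <-.
rewrite fctE bcoordZ -[in qcomp _ _ p]pk.
have := congr1 (fun f => f p) (qPh (co i) g k (fco i)) => /= ->.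
have [<-|_] := eqVneq k g; last by rewrite mul0r.
have [kml|_] := eqVneq (k * m)%g l; last by rewrite bcoord0 mulr0.
by rewrite -kml mulKg eqxx in mkl.
Qed.

End DualGrading.

(** * Homogeneous dual bases *)

Section DualBases.
Variables (G : groupType) (F : fieldType) (V : lmodType F) (d : Order.disp_t).
Variables (I : orderType d) (b : I -> V).
Hypothesis hb : is_basis b.
Hypothesis hwo : wochoice.well_order (fun u v : I => (u <= v)%O).
Variables (gamma : I -> G) (P : G -> V -> V).
Hypothesis hP : projections hb gamma P.
Implicit Types (g h k : G) (u v w i j s t : I) (f : V -> F^o).
Local Notation co := (bcoord hb).

Definition homog_vec u p := [/\ below hb u p, co u p = 1 & P (gamma u) p = p].

Definition homog_covec u (q : V -> F^o) :=
  [/\ finitary b q, row_below b u q, q (b u) = 1 & q \o P (gamma u) = q].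

(** A union of components of the graph joining [i] and [u] when some projection has a nonzero entry
    at (i, u). *)
Definition proj_closed (C : set I) :=
  forall i u g, co i (P g (b u)) != 0 -> (C i <-> C u).

Definition dual_system (C : set I) (X : seq I) (p : I -> V) (q : I -> V -> F^o) :=
  [/\ uniq X,
      forall u, u \in X -> [/\ C u, homog_vec u (p u) & homog_covec u (q u)],
      forall u, u \in X -> (forall i, ~ C i -> co i (p u) = 0) /\
        (forall i, ~ C i -> q u (b i) = 0)
    & forall u v, u \in X -> v \in X -> q u (p v) = (u == v)%:R].

Lemma homog_eval g h p (q : V -> F^o) : finitary b q -> P g p = p -> q \o P h = q ->
  q p != 0 -> g = h.
Proof.
move=> fq gp hq; have -> : q p = q (P h (P g p)) by rewrite gp -[in LHS]hq.
rewrite (proj_orth hP); case: (eqVneq h g) => [->|_] //.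
by rewrite (linmap0 fq.1) eqxx.
Qed.

(** Gram-Schmidt applied to [P (gamma u) (b u)]. A nonzero pairing with [q i] forces [i < u], which
    saves the leading term, and equal degrees, which saves homogeneity. *)
Lemma dual_vector C X p (q : I -> V -> F^o) u : proj_closed C -> dual_system C X p q ->
  C u -> u \notin X ->
  exists p', [/\ homog_vec u p', forall i, ~ C i -> co i p' = 0
    & forall j, j \in X -> q j p' = 0].
Proof.
move=> cC [uX hX sX dX] Cu uX'; pose p0 := P (gamma u) (b u).
have P0 : P (gamma u) p0 = p0 by rewrite /p0 (proj_orth hP) eqxx.
have p0u : below hb u p0 by exact: (proj_below hP).
have lq i : i \in X -> linear (q i) by move=> /hX[_ _ [[]]].
have iu i : i \in X -> q i p0 != 0 -> (i < u)%O.
  move=> iX; have [_ _ [fq qi _ _]] := hX i iX.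
  rewrite lt_neqAle; case: (eqVneq i u) => [iu|_ /=]; first by rewrite -iu iX in uX'.
  apply: contraR; rewrite -ltNge => ui; apply/eqP.
  apply: (row_below_sbelow (hb := hb) (lq i iX) qi) => j ij.
  by apply: p0u; exact: lt_le_trans ij.
exists (p0 - \sum_(i <- X) q i p0 *: p i); split; first split.
- move=> j uj; rewrite bcoordB bcoord_sum p0u // big_seq big1 ?subrr // => i iX.
  rewrite bcoordZ; have [->|/(iu i iX) {}iu] := eqVneq (q i p0) 0; first by rewrite mul0r.
  by have [_ [pi _ _] _] := hX i iX; rewrite pi ?mulr0 // (lt_trans iu).
- rewrite bcoordB bcoord_sum (proj_diag hP) eqxx big_seq big1 ?subr0 // => i iX.
  rewrite bcoordZ; have [->|/(iu i iX) {}iu] := eqVneq (q i p0) 0; first by rewrite mul0r.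
  by have [_ [pi _ _] _] := hX i iX; rewrite pi ?mulr0.
- have lP := proj_linear hP (gamma u).
  rewrite (linmapB lP) P0 (linmap_sum lP); congr (_ - _).
  apply: eq_big_seq => i iX; rewrite (linmapZ lP).
  have [->|qi] := eqVneq (q i p0) 0; first by rewrite !scale0r.
  have [_ [_ _ Pi] [fq _ _ qP]] := hX i iX.
  by rewrite (homog_eval fq P0 qP qi) Pi.
- move=> i nC; rewrite bcoordB bcoord_sum big_seq big1 => [|j jX]; last first.
    by rewrite bcoordZ (sX j jX).1 // mulr0.
  rewrite subr0; apply/eqP; apply: contraT => /cC; tauto.
- move=> j jX; rewrite (linmapB (lq j jX)) (linmap_sum (lq j jX)).
  rewrite (bigD1_seq j) //= big_seq_cond big1 => [|i /andP[iX ij]].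
    by rewrite (linmapZ (lq j jX)) dX // eqxx [_ *: _]mulr1 addr0 subrr.
  by rewrite (linmapZ (lq j jX)) dX // eq_sym (negbTE ij) scaler0.
Qed.

(** Subtracting from [f] its part [r] in the span of the [q i] leaves an [f'] that kills every
    [p i]. If [f'] is nonzero, its first index [u] is new; normalized, [f'] becomes [q u], and
    [dual_vector] supplies [p u]. *)
Lemma homog_covec_extend C X p (q : I -> V -> F^o) k f : proj_closed C -> dual_system C X p q ->
  finitary b f -> f \o P k = f -> (forall i, ~ C i -> f (b i) = 0) ->
  exists X' p' (q' : I -> V -> F^o), [/\ dual_system C X' p' q', {subset X <= X'},
    forall i, i \in X -> p' i = p i /\ q' i = q i
    & lin_span (q' @` [set` X']) f].
Proof.
move=> cC sys ff kf Cf; have [uX hX sX dX] := sys.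
pose r : V -> F^o := \sum_(i <- X) f (p i) *: q i; pose f' : V -> F^o := f - r.
have lf := ff.1.
have fE : f = r + f' by rewrite addrC subrK.
have spanr : lin_span (q @` [set` X]) r.
  by apply: lin_span_sum => i iX; apply/lin_spanZ/lin_span_gen; exists i.
have fr : finitary b r.
  rewrite /r big_seq; apply: (big_ind (finitary b)) => [|x y fx fy|i iX].
  - exact: finitary0.
  - by rewrite -[x]scale1r; apply: finitary_lin.
  - by apply: finitaryZ; have [_ _ []] := hX i iX.
have ff' : finitary b f' by rewrite /f' addrC -scaleN1r; apply: finitary_lin.
have lf' := ff'.1.
have f'E z : f' z = f z - \sum_(i <- X) f (p i) * q i z.
  by rewrite /f' /r !fctE sum_app.
have f'p j : j \in X -> f' (p j) = 0.
  move=> jX; rewrite f'E (bigD1_seq j) //= big_seq_cond big1 => [|i /andP[iX ij]].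
    by rewrite dX // eqxx mulr1 addr0 subrr.
  by rewrite dX // (negbTE ij) mulr0.
have kf' : f' \o P k = f'.
  apply/funext => z; rewrite /= !f'E -[f (P k z)]/((f \o P k) z) kf; congr (_ - _).
  apply: eq_big_seq => i iX; have [->|fpi] := eqVneq (f (p i)) 0; first by rewrite !mul0r.
  have [_ [_ _ Pi] [_ _ _ qP]] := hX i iX.
  by rewrite -(homog_eval ff Pi kf fpi) -[in RHS]qP.
have Cf' i : ~ C i -> f' (b i) = 0.
  move=> nC; rewrite f'E Cf // big_seq big1 ?subrr // => j jX.
  by rewrite (sX j jX).2 // mulr0.
have [f0|[u fu umin]] : f' = 0 \/ exists2 u, f' (b u) != 0 & row_below b u f'.
  have [f0|nf] := pselect (forall i, f' (b i) = 0).
    by left; apply: (linmap_ext hb) => //; exact: (finitary0 b).1.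
  right; have [|u [[/= fu umin] _]] := hwo (A := fun i => f' (b i) != 0).
    by move/existsNP: nf => [i /eqP fi]; exists i.
  exists u => // w wu; apply/eqP; apply: contraT => fw.
  by have := umin w fw; rewrite leNgt wu.
  by exists X, p, q; split=> //; rewrite fE f0 addr0.
have uX' : u \notin X.
  apply/negP => uX'; have [_ [pu pu1 _] _] := hX u uX'.
  have := f'p u uX'; rewrite (row_below_below lf' umin pu) pu1 mul1r => f0.
  by rewrite f0 eqxx in fu.
have Cu : C u by apply: contrapT => /Cf' f0; rewrite f0 eqxx in fu.
(* Evaluating [f' = f' \o P k] at [b u] brings out the diagonal entry of [P k] at [u]. *)
have kE : k = gamma u.
  move: fu; rewrite -[in X in X -> _]kf' /= (row_below_below lf' umin (proj_below hP k (u := u))).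
  by rewrite (proj_diag hP); case: (eqVneq k (gamma u)) => // _; rewrite mul0r eqxx.
have [pu [hpu Cpu qpu]] := dual_vector cC sys Cu uX'.
pose qu : V -> F^o := (f' (b u))^-1 *: f'.
have quE z : qu z = (f' (b u))^-1 * f' z by [].
have qupu : qu pu = 1.
  have [pb p1 _] := hpu.
  by rewrite quE (row_below_below lf' umin pb) p1 mul1r mulVf.
have hqu : homog_covec u qu.
  split; first exact: finitaryZ.
  - by move=> w /umin f0; rewrite quE f0 mulr0.
  - by rewrite quE mulVf.
  - by apply/funext => z; rewrite /= !quE -kE -[f' (P k z)]/((f' \o P k) z) kf'.
pose upd T (x : T) (m : I -> T) i := if i == u then x else m i.
have updX T (x : T) m i : i \in X -> upd T x m i = m i.
  by rewrite /upd; case: eqP => // ->; rewrite (negbTE uX').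
have updu T (x : T) m : upd T x m u = x by rewrite /upd eqxx.
exists (u :: X), (upd _ pu p), (upd _ qu q); split.
- split; first by rewrite /= uX'.
  + move=> v; rewrite inE => /orP[/eqP ->|vX]; first by rewrite !updu.
    by rewrite !updX //; exact: hX.
  + move=> v; rewrite inE => /orP[/eqP ->|vX].
      rewrite !updu; split=> [|i nC]; [exact: Cpu | by rewrite quE (Cf' i nC) mulr0].
    by rewrite !updX //; exact: sX.
  + move=> v w; rewrite !inE => /orP[/eqP ->|vX] /orP[/eqP ->|wX].
    * by rewrite !updu eqxx.
    * rewrite updu updX // quE f'p // mulr0; case: eqP => // uw.
      by rewrite uw wX in uX'.
    * rewrite updu updX // qpu //; case: eqP => // uw.
      by rewrite -uw vX in uX'.
    * by rewrite !updX // dX.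
- by move=> i iX; rewrite inE iX orbT.
- by move=> i iX; rewrite !updX.
- rewrite fE; apply: lin_spanD.
    apply: lin_span_sub spanr => _ [i /= iX <-]; apply: lin_span_gen.
    by exists i; rewrite /= ?inE ?iX ?orbT ?updX.
  have -> : f' = f' (b u) *: qu by rewrite /qu scalerA mulfV // scale1r.
  apply/lin_spanZ/lin_span_gen; exists u; by [rewrite /= inE eqxx | rewrite updu].
Qed.

Definition system_ext (X X' : seq I) (p p' : I -> V) (q q' : I -> V -> F^o) :=
  {subset X <= X'} /\ forall i, i \in X -> p' i = p i /\ q' i = q i.

Lemma system_ext_refl X p q : system_ext X X p p q q.
Proof. by split. Qed.

Lemma system_ext_trans X X' X'' p p' p'' q q' q'' :
  system_ext X X' p p' q q' -> system_ext X' X'' p' p'' q' q'' ->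
  system_ext X X'' p p'' q q''.
Proof.
move=> [XX' E] [XX'' E']; split=> [i /XX'/XX'' //|i iX].
by have [-> ->] := E' i (XX' i iX); exact: E.
Qed.

Lemma system_ext_span X X' p p' q q' : system_ext X X' p p' q q' ->
  lin_span (q @` [set` X]) `<=` lin_span (q' @` [set` X']).
Proof.
move=> [XX' E]; apply: lin_span_sub => _ [i /= iX <-]; apply: lin_span_gen.
by exists i; [exact: XX' | have [] := E i iX].
Qed.

(** [co t] is a finite sum of homogeneous covectors [co t \o P g], adjoined one at a time. *)
Lemma bcoord_extend C X p q t : proj_closed C -> dual_system C X p q -> C t ->
  exists X' p' q', [/\ dual_system C X' p' q', system_ext X X' p p' q q',
    t \in X' & lin_span (q' @` [set` X']) (co t)].
Proof.
move=> cC sys Ct; have [s sE] := proj_sum hP t.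
have [X' [p' [q' [sys' ext' span']]]] : exists X' p' q',
    [/\ dual_system C X' p' q', system_ext X X' p p' q q'
      & lin_span (q' @` [set` X']) (co t)].
  rewrite sE; elim: s {sE} => [|g s [X1 [p1 [q1 [sys1 ext1 span1]]]]].
    exists X, p, q; split=> //; first exact: system_ext_refl.
    by rewrite big_nil; exact: lin_span0.
  have lg := proj_linear hP g.
  have [||i nC|X2 [p2 [q2 [sys2 sub2 agree2 span2]]]] :=
      @homog_covec_extend C X1 p1 q1 g (co t \o P g) cC sys1.
  - split; first by move=> a z z' /=; rewrite lg bcoordP.
    by have [Y Y0] := proj_row hP t; exists Y => v /Y0 /= ->.
  - by apply/funext => z; rewrite /= (proj_orth hP) eqxx.
  - by apply/eqP; apply: contraT => /= /(cC _ _ _) H; case: nC; apply/H.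
  have ext2 : system_ext X1 X2 p1 p2 q1 q2 by [].
  exists X2, p2, q2; split=> //; first exact: system_ext_trans ext2.
  rewrite big_cons; apply: lin_spanD => //.
  exact: system_ext_span ext2 _ span1.
(* If [t] were missing, [dual_vector] would give a vector with coordinate 1 at [t] killed by all
   [q' i], hence by [co t]. *)
exists X', p', q'; split=> //; apply: contraT => tX'.
have [pt [[_ pt1 _] _ qpt]] := dual_vector cC sys' Ct tX'.
suff pt0 : co t pt = 0 by move/eqP: pt1; rewrite pt0 eq_sym oner_eq0.
move: (co t) span'; apply: lin_span_ind => [|a f f' f0 f'0|_ [i /= iX <-]] //.
- by rewrite -[LHS]/(a *: f pt + f' pt) f0 f'0 scaler0 addr0.
- exact: qpt.
Qed.

Lemma bcoord_extend_seq C X p q (l : seq I) : proj_closed C -> dual_system C X p q ->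
  exists X' p' q', [/\ dual_system C X' p' q', system_ext X X' p p' q q'
    & forall t, t \in l -> C t -> t \in X' /\ lin_span (q' @` [set` X']) (co t)].
Proof.
move=> cC sys; elim: l => [|t l [X1 [p1 [q1 [sys1 ext1 H1]]]]].
  by exists X, p, q; split=> //; exact: system_ext_refl.
have [Ct|nC] := pselect (C t); last first.
  exists X1, p1, q1; split=> // t'; rewrite inE => /orP[/eqP -> /nC //|]; exact: H1.
have [X2 [p2 [q2 [sys2 ext2 tX span]]]] := bcoord_extend cC sys1 Ct.
exists X2, p2, q2; split=> //; first exact: system_ext_trans ext2.
move=> t'; rewrite inE => /orP[/eqP -> _ //|tl Ct'].
have [tX1 span1] := H1 t' tl Ct'; split; first exact: ext2.1.
exact: system_ext_span ext2 _ span1.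
Qed.

(** Quantifying over all closed sets makes this an equivalence relation at once; its classes are the
    blocks. *)
Definition connected s t := forall C, proj_closed C -> (C s <-> C t).

Lemma connected_closed s : proj_closed (connected s).
Proof.
move=> i u g /= iu; split=> H C cC; have := cC _ _ _ iu; have := H C cC; tauto.
Qed.

(** Breadth-first search from [s]: by local finiteness in both directions each index has finitely
    many neighbours. *)
Lemma connected_countable s : exists B : nat -> seq I,
  forall t, connected s t -> exists n, t \in B n.
Proof.
have [R hR] := choice (proj_row hP); have [K hK] := choice (proj_col hP).
pose B n := iter n (fun X : seq I => flatten [seq R i ++ K i | i <- X]) [:: s].
exists B => t st; have := (st (fun t => exists n, t \in B n) _).1; apply; last first.
  by exists 0%N; rewrite inE.
have BS n i u : i \in B n -> u \in R i ++ K i -> u \in B n.+1.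
  by move=> iB uR; apply/flattenP; exists (R i ++ K i) => //; apply/map_f.
move=> i u g iu; split=> -[n nB]; exists n.+1; apply: BS nB _; rewrite mem_cat.
- apply/orP; left; apply: contraNT iu => uR; apply/eqP; exact: hR.
- apply/orP; right; apply: contraNT iu => iK; apply/eqP; exact: hK.
Qed.

(** In a chain of finite dual systems, the step from stage [n] adjoins [co t] for each [t] of the
    block in [B n]. Pairs once chosen never change, so the union is dual, and every [co u] is
    reached. *)
Lemma connected_dual_bases s : exists (p : I -> V) (q : I -> V -> F^o),
  (forall u, connected s u -> [/\ homog_vec u (p u), homog_covec u (q u),
     forall i, ~ connected s i -> co i (p u) = 0,
     forall i, ~ connected s i -> q u (b i) = 0
   & lin_span (q @` connected s) (co u)]) /\
  (forall u v, connected s u -> connected s v -> q u (p v) = (u == v)%:R).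
Proof.
have [B hB] := connected_countable s; have cC := @connected_closed s.
pose St := (seq I * (I -> V) * (I -> V -> F^o))%type.
pose good (x : St) := dual_system (connected s) x.1.1 x.1.2 x.2.
pose ext (x y : St) := system_ext x.1.1 y.1.1 x.1.2 y.1.2 x.2 y.2.
have /choice[f hf] (nx : nat * St) : exists y : St, good nx.2 ->
    [/\ good y, ext nx.2 y & forall t, t \in B nx.1 -> connected s t ->
       t \in y.1.1 /\ lin_span (y.2 @` [set` y.1.1]) (co t)].
  have [gx|] := pselect (good nx.2); last by exists nx.2.
  have [X [p [q H]]] := bcoord_extend_seq (B nx.1) cC gx.
  by exists (X, p, q).
pose x0 : St := ([::], fun=> 0, fun _ _ => 0).
pose x := fix x n : St := if n is m.+1 then f (m, x m) else x0.
have gx n : good (x n).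
  by elim: n => [|n gn]; [split | have [] := hf (n, x n) gn].
have extS n : ext (x n) (x n.+1) by have [] := hf (n, x n) (gx n).
have ext_le m n : (m <= n)%N -> ext (x m) (x n).
  move=> mn; rewrite -(subnKC mn); elim: (n - m)%N => [|k IH].
    by rewrite addn0; exact: system_ext_refl.
  by rewrite addnS; exact: system_ext_trans IH (extS _).
have inx u : connected s u -> exists n,
    u \in (x n).1.1 /\ lin_span ((x n).2 @` [set` (x n).1.1]) (co u).
  move=> su; have [n nB] := hB u su; exists n.+1.
  by have [_ _] := hf (n, x n) (gx n); apply.
have /choice[n hn] u : exists n, connected s u ->
    u \in (x n).1.1 /\ lin_span ((x n).2 @` [set` (x n).1.1]) (co u).
  have [/inx[n ?]|] := pselect (connected s u); first by exists n.
  by exists 0%N.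
(* Values are read at some stage containing [u]; by [agree] the stage does not matter. *)
pose p u := (x (n u)).1.2 u; pose q u := (x (n u)).2 u.
have agree m u : u \in (x m).1.1 -> connected s u ->
    p u = (x m).1.2 u /\ q u = (x m).2 u.
  move=> um su; have [un _] := hn u su; rewrite /p /q.
  have [/ext_le[_ E]|/ltnW/ext_le[_ E]] := leqP m (n u).
    by have [-> ->] := E u um.
  by have [-> ->] := E u un.
exists p, q; split=> [u su|u v su sv].
  have [un span] := hn u su; have [uX hX sX dX] := gx (n u).
  have [_ h1 h2] := hX u un; have [h3 h4] := sX u un; split=> //.
  apply: lin_span_sub span => _ [i /= iX <-]; apply: lin_span_gen.
  have [si _ _] := hX i iX; exists i => //.
  by have [_ ->] := agree _ _ iX si.
have [un _] := hn u su; have [vn _] := hn v sv.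
pose m := maxn (n u) (n v).
have um : u \in (x m).1.1 by apply: (ext_le (n u) m _).1 => //; exact: leq_maxl.
have vm : v \in (x m).1.1 by apply: (ext_le (n v) m _).1 => //; exact: leq_maxr.
have [_ ->] := agree m u um su; have [-> _] := agree m v vm sv.
by have [_ _ _] := gx m; apply.
Qed.

(** Gluing of the blocks: across two blocks the supports are disjoint, so the pairing is zero. *)
Lemma dual_bases : exists (p : I -> V) (q : I -> V -> F^o),
  [/\ forall u, homog_vec u (p u), forall u, homog_covec u (q u),
      forall u v, q u (p v) = (u == v)%:R
    & forall u, lin_span (range q) (co u)].
Proof.
have /choice[p /choice[q hpq]] := connected_dual_bases.
have [[o _]|noI] := pselect (exists o : I, True); last first.
  by exists (fun=> 0), (fun _ _ => 0); split=> u; case: noI; exists u.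
(* [xget] depends only on the block as a set, so [rep] is constant on it; the block contains [u], so
   the default [o] does not intervene. *)
pose rep u := xget o (connected u).
have repP u : connected (rep u) u.
  have : connected u (rep u) by apply: (xgetPex o); exists u.
  by move=> H C cC; have := H C cC; tauto.
have repE u v s : connected s u -> connected s v -> rep u = rep v.
  move=> su sv; congr (xget o _); apply/funext => t; apply/propext.
  by split=> H C cC; have := H C cC; have := su C cC; have := sv C cC; tauto.
exists (fun u => p (rep u) u), (fun u => q (rep u) u); split=> [u|u|u v|u].
- by have [] := (hpq (rep u)).1 u (repP u).
- by have [] := (hpq (rep u)).1 u (repP u).
- have [uv|uv] := eqVneq (rep u) (rep v).
    rewrite -uv; apply: (hpq (rep u)).2; first exact: repP.
    by rewrite uv; exact: repP.
  have [_ [[lq _] _ _ _] _ qu _] := (hpq (rep u)).1 u (repP u).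
  have [_ _ pv _ _] := (hpq (rep v)).1 v (repP v).
  have [s [_ _ ->]] := linmap_expand hb (p (rep v) v) lq.
  rewrite big1 => [|i _]; first by case: (eqVneq u v) uv => // ->; rewrite eqxx.
  have [ui|nu] := pselect (connected (rep u) i); last by rewrite qu // scaler0.
  have [vi|nv] := pselect (connected (rep v) i); last by rewrite pv // scale0r.
  by rewrite (repE _ _ _ (repP u) ui) (repE _ _ _ (repP v) vi) eqxx in uv.
- have [_ _ _ _] := (hpq (rep u)).1 u (repP u).
  apply: lin_span_sub => _ [i /= ui <-]; apply: lin_span_gen; exists i => //.
  by rewrite (repE _ _ _ ui (repP u)).
Qed.

End DualBases.

(** * Isomorphism with an elementary grading *)

Section Isomorphism.
Variables (G : groupType) (F : fieldType) (V : lmodType F) (d : Order.disp_t).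
Variables (I : orderType d) (b : I -> V).
Hypothesis hb : is_basis b.
Hypothesis hwo : wochoice.well_order (fun u v : I => (u <= v)%O).
Implicit Types (g h k : G) (u v w i j : I) (x y : V -> V) (z : V).
Local Notation co := (bcoord hb).
Local Notation A := (UT b).
Local Notation e := (matrix_unit b).

Lemma UT_kernel x : A x -> exists X : seq I,
  forall z, (forall j, j \in X -> co j z = 0) -> x z = 0.
Proof.
move=> /(UTP hb)[lx _ [X X0]]; exists X => z zX.
have [s [_ _ ->]] := linmap_expand hb z lx; rewrite big1 // => i _.
have [iX|/X0 ->] := boolP (i \in X); last by rewrite scaler0.
by rewrite zX // scale0r.
Qed.

(** [S] and [S'] preserve the flag. As [x] reads finitely many coordinates, each nonzero on finitely
    many [S (b v)], finitely many nonzero columns remain. *)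
Lemma UT_conj (S S' : V -> V) : linear S -> linear S' ->
  (forall u, below hb u (S (b u))) -> (forall u, below hb u (S' (b u))) ->
  (forall j, exists X : seq I, forall v, v \notin X -> co j (S (b v)) = 0) ->
  forall x, A x -> A (S' \o x \o S).
Proof.
move=> lS lS' bS bS' /choice[K hK] x Ax; have [lx bx _] := (UTP hb x).1 Ax.
have S'b u z : below hb u z -> below hb u (S' z).
  move=> zu w uw; have [s [_ _ ->]] := linmap_expand hb z lS'.
  rewrite bcoord_sum big1 // => i _; rewrite bcoordZ.
  have [ui|iu] := ltP u i; first by rewrite zu // mul0r.
  by rewrite bS' ?mulr0 // (le_lt_trans iu).
apply/(UTP hb); split.
- by move=> a z z' /=; rewrite lS lx lS'.
- by move=> u; apply/S'b/UT_below.
- have [X hX] := UT_kernel Ax; exists (flatten [seq K j | j <- X]) => v nv /=.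
  rewrite hX ?linmap0 // => j jX; apply: hK; apply: contra nv => vK.
  by apply/flattenP; exists (K j) => //; exact: map_f.
Qed.

(** [T'] sends [z] to the sum of the [q i z *: b i]. [T' \o T] is the identity by duality; [T \o T']
    is tested on each [co i], a combination of covectors [q j], for which the claim is clear. *)
Lemma dual_bases_inverse (gamma : I -> G) (P : G -> V -> V) (p : I -> V)
    (q : I -> V -> F^o) :
  (forall u, homog_vec hb gamma P u (p u)) ->
  (forall u, homog_covec b gamma P u (q u)) ->
  (forall u v, q u (p v) = (u == v)%:R) ->
  (forall u, lin_span (range q) (co u)) ->
  exists T T' : V -> V, [/\ linear T, linear T', cancel T T' & cancel T' T] /\
    [/\ forall u, T (b u) = p u & forall i z, co i (T' z) = q i z].
Proof.
move=> hp hq pq spanq.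
have lq i : linear (q i) by have [[]] := hq i.
pose fin z := exists X : seq I, forall i, i \notin X -> q i z = 0.
have fin0 : fin 0 by exists [::] => i _; rewrite (linmap0 (lq i)).
have fin_lin a z z' : fin z -> fin z' -> fin (a *: z + z').
  move=> [X X0] [Y Y0]; exists (X ++ Y) => i; rewrite mem_cat negb_or.
  by move=> /andP[iX iY]; rewrite lq X0 // Y0 // scaler0 addr0.
(* [b u] is [p u], seen by [q u] alone, minus a combination of smaller [b i]. *)
have finb : forall u, fin (b u).
  apply: (well_order_ind hwo) => u IH; have [pu pu1 _] := hp u.
  have -> : b u = p u - (p u - co u (p u) *: b u) by rewrite pu1 scale1r subKr.
  have su := sbelow_sub pu; rewrite addrC -scaleN1r; apply: (fin_lin); last first.
    by exists [:: u] => i; rewrite inE pq => /negbTE ->.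
  have [s [_ _ ->]] := bcoord_expand hb (p u - co u (p u) *: b u).
  apply: (big_ind fin) => // [z z' fz fz'|i _]; first by rewrite -[z]scale1r; apply: (fin_lin).
  have [ui|iu] := leP u i; first by rewrite su // scale0r.
  by rewrite -[_ *: _]addr0; apply: (fin_lin) => //; exact: IH.
have [X hX] := choice finb.
have [T lT Tb] := linear_extension hb p.
have [T' lT' T'b] := linear_extension hb (fun u => \sum_(i <- undup (X u)) q i (b u) *: b i).
have coT' i z : co i (T' z) = q i z.
  suff E : co i \o T' = q i by rewrite -E.
  apply: (linmap_ext hb) => // [a z1 z2|u] /=; first by rewrite lT' bcoordP.
  rewrite T'b bcoord_sum; have [iX|iX] := boolP (i \in X u).
    rewrite (bigD1_seq i) ?mem_undup ?undup_uniq //= bcoordZ bcoord_basis eqxx mulr1.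
    rewrite big1 ?addr0 // => j ji.
    by rewrite bcoordZ bcoord_basis eq_sym (negbTE ji) mulr0.
  rewrite hX // big_seq big1 // => j; rewrite mem_undup bcoordZ bcoord_basis => jX.
  by case: (eqVneq i j) iX => [->|_]; rewrite ?jX ?mulr0.
have qT i z : q i (T z) = co i z.
  suff E : q i \o T = co i by rewrite -E.
  apply: (linmap_ext hb) => // [a z1 z2||u] /=.
  - by rewrite lT lq.
  - exact: bcoord_linear.
  - by rewrite Tb pq bcoord_basis.
exists T, T'; split=> //; split=> // z; apply: (bcoord_ext (hb := hb)) => i.
  by rewrite coT' qT.
move: (co i) (spanq i); apply: lin_span_ind => [|a f f' f0 f'0|_ [j _ <-]] //.
- by rewrite -[LHS]/(a *: f (T (T' z)) + f' (T (T' z))) f0 f'0.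
- by rewrite qT coT'.
Qed.

Lemma isomorphic_elementary (Ag : G -> set (V -> V)) (o : I) :
  is_grading A Ag -> (forall u, (o <= u)%O) ->
  exists gamma : I -> G, isomorphic_gradings A Ag (elementary b gamma).
Proof.
move=> hG ho; have [gamma [P [hP homogA]]] := projections_ex hb hwo hG ho.
have [p [q [hp hq pq spanq]]] := dual_bases hwo hP.
have [T [T' [[lT lT' TK T'K] [Tb coT']]]] := dual_bases_inverse hp hq pq spanq.
have bT u : below hb u (T (b u)) by rewrite Tb; have [] := hp u.
have bT' u : below hb u (T' (b u)).
  move=> w uw; rewrite coT'; have [[lq _] qw _ _] := hq w.
  apply: (row_below_sbelow (hb := hb) lq qw) => i wi.
  by rewrite bcoord_basis gt_eqF // (lt_le_trans uw).
(* [co j] is a combination of the [q i], each nonzero on a single [p v]; for [T'] the covector in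
   question is the finitary [q j]. *)
have cT j : exists X : seq I, forall v, v \notin X -> co j (T (b v)) = 0.
  move: (co j) (spanq j); apply: lin_span_ind => [|a f f' [X X0] [Y Y0]|_ [i _ <-]].
  - by exists [::].
  - exists (X ++ Y) => v; rewrite mem_cat negb_or => /andP[/X0 f0 /Y0 f'0].
    by rewrite -[LHS]/(a *: f (T (b v)) + f' (T (b v))) f0 f'0 scaler0 addr0.
  - by exists [:: i] => v; rewrite inE Tb pq eq_sym => /negbTE ->.
have cT' j : exists X : seq I, forall v, v \notin X -> co j (T' (b v)) = 0.
  have [[_ [X X0]] _ _ _] := hq j; exists X => v /X0; by rewrite coT'.
pose phi x := T' \o x \o T; pose psi x := T \o x \o T'.
have Aphi x : A x -> A (phi x) by exact: UT_conj.
have Apsi x : A x -> A (psi x) by exact: UT_conj.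
have phiK : cancel phi psi by move=> x; apply/funext => z; rewrite /phi /psi /= !T'K.
have psiK : cancel psi phi by move=> x; apply/funext => z; rewrite /phi /psi /= !TK.
have phi_lin a x y : phi (a *: x + y) = a *: phi x + phi y.
  by apply/funext => z; rewrite /phi !fctE lT'.
have psi_lin a x y : psi (a *: x + y) = a *: psi x + psi y.
  by apply/funext => z; rewrite /psi !fctE lT.
have psi_unit u v : (u <= v)%O -> Ag ((gamma u)^-1 * gamma v)%g (psi (e u v)).
  move=> uv; have -> : psi (e u v) = rank_one (p u) (q v).
    apply/funext => z; rewrite /psi /= (matrix_unitE hb) /rank_one coT'.
    by rewrite linmapZ // Tb.
  have [pu _ Pu] := hp u; have [fv qv _ Pv] := hq v.
  apply: (homogA _ _ u) => // w wu; apply: qv; exact: lt_le_trans uv.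
exists gamma, phi; split.
  split=> [|a x y _ _|x y _ _]; first split=> [x /Aphi //|x y _ _ xy|y Ay].
  - by rewrite -(phiK x) xy phiK.
  - by exists (psi y); [exact: Apsi | exact: psiK].
  - exact: phi_lin.
  - by apply/funext => z; rewrite /phi /= T'K.
move=> g; apply/seteqP; split=> [_ [x gx <-]|y].
  (* The inclusion is restated for the degree [g] component of [psi y], with [y] arbitrary, so that
     it can be checked on matrix units; [y = phi x] gives it back. *)
  have : forall y, A y -> A (psi y) /\ elementary b gamma g (phi (hcomp Ag (psi y) g)).
    have phi0 : phi 0 = 0 by apply/funext => z; rewrite /phi !fctE linmap0.
    have psi0 : psi 0 = 0 by apply/funext => z; rewrite /psi !fctE linmap0.
    apply: lin_span_ind => [|a y y' [Ay hy] [Ay' hy']|_ [u [v [uv ->]]]].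
    - rewrite psi0 (hcomp0 hG) phi0; split; [exact: UT0 | exact: lin_span0].
    - rewrite psi_lin (hcomp_lin hG) // phi_lin; split; first exact: UT_lin.
      by apply: lin_spanD => //; exact: lin_spanZ.
    - have guv := psi_unit u v uv; split; first exact: (grade_UT hG guv).
      rewrite (hcomp_homog hG _ guv); case: eqP => [->|_]; last first.
        by rewrite phi0; exact: lin_span0.
      by rewrite psiK; apply: lin_span_gen; exists u, v.
  move=> /(_ (phi x) (Aphi _ (grade_UT hG gx)))[_].
  by rewrite phiK (hcomp_homog hG _ gx) eqxx.
move=> gy; exists (psi y); last exact: psiK.
move: y gy; apply: lin_span_ind => [|a y y' gy gy'|_ [u [v [uv <- ->]]]].
- have -> : psi 0 = 0 by apply/funext => z; rewrite /psi !fctE linmap0.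
  exact: (grade0 hG).
- by rewrite psi_lin; apply: (grade_lin hG).
- exact: psi_unit.
Qed.

End Isomorphism.

(** * Isomorphisms between elementary gradings *)

Section Uniqueness.
Variables (G : groupType) (F : fieldType) (V : lmodType F) (d : Order.disp_t).
Variables (I : orderType d) (b : I -> V).
Hypothesis hb : is_basis b.
Hypothesis hwo : wochoice.well_order (fun u v : I => (u <= v)%O).
Implicit Types (g h k : G) (u v w i j : I) (x y : V -> V) (z : V).
Local Notation co := (bcoord hb).
Local Notation A := (UT b).
Local Notation e := (matrix_unit b).

Lemma elementary_entry (gamma : I -> G) g x u v : elementary b gamma g x ->
  co u (x (b v)) != 0 -> g = ((gamma u)^-1 * gamma v)%g.
Proof.
move=> gx x0; apply/eqP; apply: contraNT x0 => gE; apply/eqP.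
move: x gx; apply: lin_span_ind => [|a x y x0 y0|_ [i [j [_ ij ->]]]].
- exact: bcoord0.
- by rewrite bcoordP x0 y0 mulr0 addr0.
- rewrite (matrix_unitE hb) /rank_one bcoordZ !bcoord_basis.
  case: (eqVneq u i) => [ui|_]; last by rewrite mulr0.
  case: (eqVneq j v) => [jv|_]; last by rewrite mul0r.
  by rewrite ui -jv ij eqxx in gE.
Qed.

Lemma leading_index z : z != 0 -> exists2 u, co u z != 0 & below hb u z.
Proof.
have maxs (s : seq I) : s != [::] -> exists2 u, u \in s & forall i, i \in s -> (i <= u)%O.
  elim: s => // t s IH _; have [->|/IH[u us umax]] := eqVneq s [::].
    by exists t; rewrite ?inE // => i; rewrite inE => /eqP ->.
  have [tu|ut] := leP t u.
    by exists u => [|i]; rewrite inE ?us ?orbT // => /orP[/eqP -> //|/umax].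
  exists t => [|i]; rewrite inE ?eqxx // => /orP[/eqP -> //|/umax iu].
  exact: le_trans iu (ltW ut).
move=> z0; have [s [us s0 _]] := bcoord_expand hb z.
have [|u] := maxs [seq i <- s | co i z != 0].
  apply: contra z0 => /eqP s1; apply/eqP/(bcoord_ext (hb := hb)) => i; rewrite bcoord0.
  apply/eqP; apply: contraT => ci; have : i \in [seq i <- s | co i z != 0].
    by rewrite mem_filter ci; apply: contraNT ci => /s0 ->.
  by rewrite s1.
rewrite mem_filter => /andP[cu us'] umax; exists u => // i ui.
apply/eqP; apply: contraTT ui => ci; rewrite -leNgt; apply: umax.
by rewrite mem_filter ci; apply: contraNT ci => /s0 ->.
Qed.

Section Automorphism.
Variable phi : (V -> V) -> V -> V.
Hypothesis hphi : is_algebra_automorphism A phi.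

Let phi_UT x : A x -> A (phi x).
Proof. by have [[+ _ _] _ _] := hphi; apply. Qed.

Let phi_surj y : A y -> exists2 x, A x & phi x = y.
Proof. by have [[_ _ S] _ _] := hphi => /S[x Ax <-]; exists x. Qed.

Let phi_comp x y : A x -> A y -> phi (x \o y) = phi x \o phi y.
Proof. by have [_ _] := hphi; apply. Qed.

Let phi0 : phi 0 = 0.
Proof.
have [_ + _] := hphi => /(_ (-1) 0 0 (UT0 b) (UT0 b)).
by rewrite scaleN1r addNr scaleN1r addNr.
Qed.

Let phiZ a x : A x -> phi (a *: x) = a *: phi x.
Proof.
have [_ + _] := hphi => /(_ a x 0) L Ax; have := L Ax (UT0 b).
by rewrite phi0 !addr0.
Qed.

Let f u := phi (e u u).

Let Ae u : A (e u u).
Proof. exact: UT_matrix_unit. Qed.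

Let Af u : A (f u).
Proof. exact: phi_UT. Qed.

Lemma sandwich u v y : A y ->
  e u u \o y \o e v v = co u (y (b v)) *: e u v.
Proof.
move=> Ay; apply/funext => z; rewrite /= fctE !(matrix_unitE hb) /rank_one.
by rewrite (linmapZ (UT_linear hb Ay)) bcoordZ scalerA mulrC.
Qed.

(** This is the image of [e u u \o y \o e v v], a multiple of [e u v] that vanishes unless
    [u <= v]. *)
Let phi_sandwich u v x : A x -> exists c,
  f u \o x \o f v = c *: phi (e u v) /\ (c != 0 -> (u <= v)%O).
Proof.
move=> /phi_surj[y Ay <-]; exists (co u (y (b v))); split.
  have [uv|vu] := leP u v.
    rewrite -phiZ; last exact: UT_matrix_unit.
    by rewrite -sandwich // -!phi_comp //; apply: UT_comp.
  have y0 : co u (y (b v)) = 0 by have [_ + _] := (UTP hb y).1 Ay; apply.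
  rewrite -!phi_comp //; last by apply: UT_comp.
  by rewrite sandwich // y0 !scale0r phi0.
by move=> y0; rewrite leNgt; apply: contra y0 => vu; have [_ -> //] := (UTP hb y).1 Ay.
Qed.

Let sandwich_entry u v w w' :
  co u ((f w \o e u v \o f w') (b v)) = diag hb u (f w) * diag hb v (f w').
Proof.
rewrite /= (matrix_unitE hb) /rank_one (linmapZ (UT_linear hb (Af w))) bcoordZ mulrC.
by [].
Qed.

(** [f w \o e u v \o f w'] has a nonzero entry at (u, v), so the constant of [phi_sandwich] is
    nonzero. *)
Let diag_le u v w w' : (u <= v)%O ->
  diag hb u (f w) != 0 -> diag hb v (f w') != 0 -> (w <= w')%O.
Proof.
move=> uv fw fw'; have [c [cE]] := phi_sandwich w w' (UT_matrix_unit b uv).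
apply; apply: contraTneq (mulf_neq0 fw fw') => c0.
by rewrite -sandwich_entry cE c0 scale0r -[(0 : V -> V) (b v)]/(0 : V) bcoord0 eqxx.
Qed.

Let diag_uniq u w w' : diag hb u (f w) != 0 -> diag hb u (f w') != 0 -> w = w'.
Proof.
by move=> fw fw'; apply/le_anti; rewrite (diag_le (lexx u) fw fw') (diag_le (lexx u) fw' fw).
Qed.

(** Otherwise the character [diag u] kills each [phi (e i j)], which has the factor [f i], and so
    the whole image of [phi], including [e u u]. *)
Let diag_ex u : exists w, diag hb u (f w) != 0.
Proof.
apply: contrapT => /forallNP nf; have [x Ax xE] := phi_surj (Ae u).
have fw w : diag hb u (f w) = 0 by apply/eqP; apply: contraT => /nf.
have : A x -> A x /\ diag hb u (phi x) = 0.
  move: x {Ax xE}; apply: lin_span_ind => [|a x y [Ax x0] [Ay y0]|_ [i [j [ij ->]]]].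
  - by rewrite phi0 /diag bcoord0; split=> //; exact: UT0.
  - have [_ -> // _] := hphi; split; first exact: UT_lin.
    by rewrite diag_lin x0 y0 mulr0 addr0.
  - have Aij := UT_matrix_unit b ij; split=> //.
    by rewrite -(matrix_unitK hb i i j) phi_comp // diag_comp ?fw ?mul0r //; exact: phi_UT.
move=> /(_ Ax)[_]; rewrite xE diag_matrix_unit eqxx => /eqP.
by rewrite oner_eq0.
Qed.

(** [f w] is a nonzero idempotent; at the leading index of a nonzero vector it fixes, its diagonal
    entry is 1. *)
Let diag_surj w : exists u, diag hb u (f w) != 0.
Proof.
have [z fz] : exists z, f w z != 0.
  apply: contrapT => /forallNP fz; have f0 : f w = 0.
    by apply/funext => z; apply/eqP; apply: contraT => /fz.
  have [[_ inj _] _ _] := hphi.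
  have /(congr1 (fun x => x (b w))) : e w w = 0.
    by apply: inj; rewrite ?phi0 // inE; [exact: Ae | exact: UT0].
  rewrite (matrix_unitE hb) /rank_one bcoord_basis eqxx scale1r => /eqP.
  by rewrite (negbTE (basis_neq0 hb w)).
have [u cu umax] := leading_index fz.
exists u; have fK : f w (f w z) = f w z.
  by rewrite -[LHS]/((f w \o f w) z) -phi_comp // matrix_unitK.
have := diag_coord (Af w) umax; rewrite fK => /eqP.
by rewrite -[X in X == _]mul1r (inj_eq (mulIf cu)) => /eqP <-; rewrite oner_eq0.
Qed.

(** By induction the index [v] where [f u] lives is at least [u], so the [w] living at [u] satisfies
    [w <= u]. If [w < u], then [f w \o e w u \o f w] is a multiple of [f w] with zero diagonal entry
    at [w], hence zero, yet its (w, u) entry is not. *)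
Let diag_id u : diag hb u (f u) != 0.
Proof.
move: u; apply: (well_order_ind hwo) => u IH.
have [w fw] := diag_ex u; have [v fv] := diag_surj u.
have uv : (u <= v)%O.
  rewrite leNgt; apply/negP => vu; have := diag_uniq (IH v vu) fv => uv.
  by rewrite uv ltxx in vu.
have := diag_le uv fw fv; rewrite le_eqVlt => /orP[/eqP wu|wu]; first by rewrite -{2}wu.
have fww := IH w wu; have [c [cE _]] := phi_sandwich w w (UT_matrix_unit b (ltW wu)).
have Awu := UT_matrix_unit b (ltW wu).
have : c * diag hb w (f w) = 0.
  rewrite -bcoordZ -[c *: _]/((c *: f w) (b w)) -cE -/(diag hb w _).
  rewrite diag_comp //; last exact: UT_comp.
  by rewrite diag_comp // diag_matrix_unit eqxx gt_eqF // mulr0 mul0r.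
move=> /eqP; rewrite mulf_eq0 (negbTE fww) orbF => /eqP c0.
have := mulf_neq0 fww fw; rewrite -sandwich_entry cE c0.
by rewrite scale0r -[(0 : V -> V) _]/(0 : V) bcoord0 eqxx.
Qed.

Lemma automorphism_entry u v : (u <= v)%O -> co u (phi (e u v) (b v)) != 0.
Proof.
move=> uv; have [c [cE _]] := phi_sandwich u v (UT_matrix_unit b uv).
have := mulf_neq0 (diag_id u) (diag_id v); rewrite -sandwich_entry cE.
by rewrite -[(_ *: _) _]/(c *: phi (e u v) (b v)) bcoordZ mulf_eq0 negb_or => /andP[].
Qed.

End Automorphism.

Lemma isomorphic_elementaryP (gamma gamma' : I -> G) :
  isomorphic_gradings A (elementary b gamma) (elementary b gamma') <->
  exists g : G, forall u : I, gamma u = (g * gamma' u)%g.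
Proof.
split=> [[phi [hphi E]]|[g gE]].
  have [[u0 _]|noI] := pselect (exists u : I, True); last first.
    by exists 1%g => u; case: noI; exists u.
  have [|o [[_ omin] _]] := hwo (A := predT); first by exists u0.
  (* The constant is forced by the least index [o]; comparing the degrees of [e o u] and its image
     gives the rest. *)
  exists (gamma o * (gamma' o)^-1)%g => u.
  have ou : (o <= u)%O by exact: omin.
  have gou : elementary b gamma ((gamma o)^-1 * gamma u)%g (e o u).
    by apply: lin_span_gen; exists o, u.
  have : elementary b gamma' ((gamma o)^-1 * gamma u)%g (phi (e o u)).
    by rewrite -E; exists (e o u).
  move=> /elementary_entry/(_ (automorphism_entry hphi ou)) /(congr1 (fun k => gamma o * k)%g).
  by rewrite mulVKg mulgA.
(* A left translation cancels in [(gamma u)^-1 * gamma v], so the two gradings coincide. *)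
exists id; split; first split=> //.
  by split=> // y Ay; exists y.
move=> g'; rewrite image_id; congr (lin_span _); apply/seteqP.
split=> x [u [v [uv gg' ->]]]; exists u, v; split=> //; rewrite -gg' !gE invgM;
  by rewrite -!mulgA mulKg.
Qed.

End Uniqueness.

Theorem theorem42 (G : groupType) (F : fieldType) (V : lmodType F)
    (d : Order.disp_t) (I : orderType d) (b : I -> V)
    (hb : is_basis b) (hwo : wochoice.well_order (fun u v : I => (u <= v)%O)) :
  (forall Ag : G -> set (V -> V), is_grading (UT b) Ag ->
     exists gamma : I -> G,
       isomorphic_gradings (UT b) Ag (elementary b gamma)) /\
  (forall gamma gamma' : I -> G,
     isomorphic_gradings (UT b) (elementary b gamma) (elementary b gamma') <->
     exists g : G, forall u : I, gamma u = (g * gamma' u)%g).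
Proof.
split=> [Ag hG|]; last exact: isomorphic_elementaryP.
have [[u0 _]|noI] := pselect (exists u : I, True).
  have [|o [[_ omin] _]] := hwo predT; first by exists u0.
  by apply: (isomorphic_elementary hb hwo hG) => u; exact: omin.
(* With no index there is no least one, but the algebra and the elementary components are all
   zero. *)
have span_empty (S : set (V -> V)) : (forall x, ~ S x) -> lin_span S = [set 0].
  move=> S0; apply/seteqP; split=> [|_ ->]; last exact: lin_span0.
  apply: lin_span_ind => [//|a x y -> ->|x /S0 //]; by rewrite /= scaler0 addr0.
have UT0E : UT b = [set 0].
  by apply: span_empty => x [u _]; apply: noI; exists u.
exists (fun=> 1%g), id; split; first split=> //.
  by split=> // y Ay; exists y.
move=> g; rewrite image_id [RHS]span_empty => [|x [u _]]; last by apply: noI; exists u.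
apply/seteqP; split=> [x /(grade_UT hG)|_ ->]; first by rewrite UT0E.
exact: grade0 hG g.
Qed.
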